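(* Let $\varphi,\psi:V\to\mathbb R$ with $\psi|_{V_1}=0$, and define $f\in F(G)$ by $f(x)=m_x\psi(x)$ for $x\in V$ and $f(\langle x,y\rangle)=[\varphi(y)-\varphi(x)]e_{xy}$ for $\langle x,y\rangle\in E$. Suppose $f\in F_0(G)$ and let $(f_t)_{t\ge0}$ be the interacting particle system started from $f$. Then $$u(x,t)=\varphi(x)+\frac1{m_x}\mathbb E_f\Big(\int_0^t f_s(x)\,ds\Big),\qquad (x,t)\in V\times[0,\infty),$$ solves the Dirichlet initial-boundary value problem $$m_x\frac{d^2u}{dt^2}(x,t)=\sum_{y\in V}k_{xy}[u(y,t)-u(x,t)]\ \ ((x,t)\in V_0\times[0,\infty)),\quad u(x,0)=\varphi(x),\ \frac{du}{dt}(x,0)=\psi(x)\ (x\in V),\quad u(x,t)=\varphi(x)\ ((x,t)\in V_1\times[0,\infty)).$$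
   Context: A graph is a quadruple $G=(V,E,K,m)$: $V$ is a finite or countable set of nodes, which are elements of a real Hilbert space $\mathcal H$ with inner product ''$\cdot$'' and norm $|\cdot|$; $E$ is a set of undirected edges (at most one edge between any two distinct nodes, no self-loops); the edge between $x$ and $y$ is written $\langle x,y\rangle=\langle y,x\rangle$, and $y\sim x$ means this edge exists; $K=(k_{xy})_{x,y\in V}$ with $k_{xy}=k_{yx}\ge0$ and $k_{xy}=0$ if there is no edge; $m=(m_x)_{x\in V}$ with $m_x>0$. Let $e_{xy}=(y-x)/|y-x|$. Assume $d_0=\sup_{x\in V}\#\{y:y\sim x\}<\infty$, set $d=\max\{d_0,2\}$, and assume $M=\max\{\sup_{x\in V}m_x^{-1},\sup_{\langle x,y\rangle\in E}k_{xy}\}<\infty$. $V=V_0\cup V_1$ is a fixed partition into disjoint sets. $F(G)$ is the set of functions $f$ assigning a real number $f(x)$ to each $x\in V$ and a vector $f(\langle x,y\rangle)\in\mathcal H$ that is a real multiple of $y-x$ to each edge. For $1\le\alpha<\infty$, $\|f\|_\alpha=\big(\sum_{x\in V}|f(x)|^\alpha/m_x+\sum_{\langle x,y\rangle\in E}k_{xy}|f(\langle x,y\rangle)|^\alpha\big)^{1/\alpha}$, and $\|f\|_\infty=\max\{\sup_x|f(x)|,\sup_{\langle x,y\rangle}|f(\langle x,y\rangle)|\}$. $F_0(G)$ is the set of $f\in F(G)$ with finitely many nonzero values such that $|f(x)|\in\mathbb Z$ and $|f(\langle x,y\rangle)|\in\mathbb Z$ for all nodes and edges. The interacting particle system (IPS)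 $(f_t)_{t\ge0}$ is the continuous-time Markov jump process on $F_0(G)$ with the following transitions from state $f$: (i) for each $x\in V$, at rate $|f(x)|/m_x$, for every $y\sim x$ the edge value $f(\langle x,y\rangle)$ is replaced by $f(\langle x,y\rangle)+\mathrm{sgn}(f(x))\,e_{yx}$ (all other values unchanged); (ii) for each edge $\langle x,y\rangle$, at rate $k_{xy}|f(\langle x,y\rangle)|$, with $s=\mathrm{sgn}(f(\langle x,y\rangle)\cdot e_{xy})$, the value $f(x)$ is replaced by $f(x)+s$ if $x\in V_0$ and $f(y)$ by $f(y)-s$ if $y\in V_0$ (values at nodes of $V_1$ never change; this rule is symmetric in $x,y$). $P_f,\mathbb E_f$ denote probability and expectation given $f_0=f$. $\tau_0=0$, $\tau_n$ is the time of the $n$-th jump, $\xi_n=\tau_n-\tau_{n-1}$, $h_n=f_{\tau_n}$, and $\eta_t=\sup\{n:\tau_n\le t\}$. *)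

(* Defs.v *)
From HB Require Import structures.
From mathcomp Require Import all_boot all_order all_algebra.
From mathcomp Require Import all_classical all_reals all_analysis.
From mathcomp Require Import measurable_realfun.
Set Implicit Arguments. Unset Strict Implicit. Unset Printing Implicit Defensive.
Import Order.TTheory GRing.Theory Num.Theory.
Import numFieldNormedType.Exports.
Local Open Scope classical_set_scope.
Local Open Scope ring_scope.

Section IPS.
Variables (R : realType) (V : countType).

(* A state f in F(G): node values f(x), and edge values encoded by a real
   coefficient c x y with f(<x,y>) = c x y * e_xy (so c y x = - c x y). *)
Definition state := ((V -> R) * (V -> V -> R))%type.

Definition inF0 (adj : rel V) (h : state) : Prop :=
  (forall x, `|h.1 x| \is a Num.nat) /\
  (forall x y, adj x y -> `|h.2 x y| \is a Num.nat) /\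
  finite_set [set x | h.1 x != 0] /\
  finite_set [set p : V * V | adj p.1 p.2 /\ h.2 p.1 p.2 != 0].

(* Possible transitions: None = no transition (only used once the total rate
   vanishes, i.e. the process is absorbed), Some (inl x) = transition (i) at
   node x, Some (inr (x,y)) = transition (ii) at the edge <x,y>, each
   unordered edge being listed once as (x,y) with pickle x < pickle y. *)
Definition event := option (V + (V * V))%type.

Definition fire (adj : rel V) (V1 : pred V) (h : state) (a : event) : state :=
  match a with
  | None => h
  | Some (inl x) =>
      (h.1, fun p q =>
              if (p == x) && adj x q then h.2 p q - Num.sg (h.1 x)
              else if (q == x) && adj x p then h.2 p q + Num.sg (h.1 x)
              else h.2 p q)
  | Some (inr (x, y)) =>
      let s := Num.sg (h.2 x y) in
      (fun z => if (z == x) && (x \notin V1) then h.1 x + s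
                else if (z == y) && (y \notin V1) then h.1 y - s
                else h.1 z, h.2)
  end.

Definition rate (m : V -> R) (k : V -> V -> R) (h : state) (a : event) : R :=
  match a with
  | None => 0
  | Some (inl x) => `|h.1 x| / m x
  | Some (inr (x, y)) =>
      if (pickle x < pickle y)%N then k x y * `|h.2 x y| else 0
  end.

Definition total_rate (m : V -> R) (k : V -> V -> R) (h : state) : R :=
  \sum_(x \in [set: V]) rate m k h (Some (inl x)) +
  \sum_(p \in [set: V * V]) rate m k h (Some (inr p)).

Definition jprob (m : V -> R) (k : V -> V -> R) (h : state) (a : event) : R :=
  match a with
  | None => if total_rate m k h == 0 then 1 else 0
  | Some _ => rate m k h a / total_rate m k h
  end.

Fixpoint chain (adj : rel V) (V1 : pred V) (h0 : state) (ev : nat -> event)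
    (n : nat) : state :=
  match n with
  | 0%N => h0
  | n.+1 => fire adj V1 (chain adj V1 h0 ev n) (ev n)
  end.

Section Process.
Variables (d : measure_display) (Omega : measurableType d)
  (P : probability Omega R).

(* (e, xi) realize the IPS started at f: e n is the transition performed at
   the (n+1)-th jump, xi n is the holding time in the state h_n
   (xi n = xi_{n+1} = tau_{n+1} - tau_n of the paper). *)
Definition is_IPS (adj : rel V) (V1 : pred V) (m : V -> R) (k : V -> V -> R)
    (f : state) (e : nat -> Omega -> event) (xi : nat -> Omega -> \bar R) :
    Prop :=
  (forall n a, measurable [set w | e n w = a]) /\
  (forall n, measurable_fun [set: Omega] (xi n : Omega -> \bar R)) /\
  (forall (n : nat) (as_ : nat -> event) (ts : nat -> R),
      (forall i, 0 <= ts i) ->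
      P [set w | forall i, (i < n)%N -> e i w = as_ i /\ ((ts i)%:E < xi i w)%E] =
      (\prod_(i < n)
         (jprob m k (chain adj V1 f as_ i) (as_ i) *
          expR (- (total_rate m k (chain adj V1 f as_ i) * ts i))))%:E).

Definition tau (xi : nat -> Omega -> \bar R) (n : nat) (w : Omega) : \bar R :=
  (\sum_(i < n) xi i w)%E.

(* eta_t = sup {n | tau_n <= t} (taken to be 0 if this set has no maximum) *)
Definition eta (xi : nat -> Omega -> \bar R) (t : R) (w : Omega) : nat :=
  xget 0%N [set n | (tau xi n w <= t%:E)%E /\
                    forall n', (tau xi n' w <= t%:E)%E -> (n' <= n)%N].

Definition ips_at (adj : rel V) (V1 : pred V) (f : state)
    (e : nat -> Omega -> event) (xi : nat -> Omega -> \bar R) (t : R)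
    (w : Omega) : state :=
  chain adj V1 f (fun i => e i w) (eta xi t w).

Definition occ (adj : rel V) (V1 : pred V) (f : state)
    (e : nat -> Omega -> event) (xi : nat -> Omega -> \bar R) (x : V) (t : R)
    (w : Omega) : \bar R :=
  (\int[@lebesgue_measure R]_(s in `[0%R, t]%classic) ((ips_at adj V1 f e xi s w).1 x)%:E)%E.

Definition u_sol (adj : rel V) (V1 : pred V) (m : V -> R) (phi : V -> R)
    (f : state) (e : nat -> Omega -> event) (xi : nat -> Omega -> \bar R)
    (x : V) (t : R) : R :=
  phi x + fine (\int[P]_w occ adj V1 f e xi x t w)%E / m x.

End Process.

Definition deriv_nonneg (g g' : R -> R) : Prop :=
  forall t, 0 <= t ->
    (fun s => (g s - g t) / (s - t)) @ within (fun s => 0 <= s /\ s != t) (nbhs t)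
      --> g' t.

End IPS.

(* Main.v *)
(* The node and edge values of the IPS change, on average, linearly:
     d/dt E f_t(x) = sum_y k_xy E c_t(x,y)              (x not in V1),
     d/dt E c_t(x,y) = E f_t(y) / m_y - E f_t(x) / m_x  (x ~ y),
   where c_t(x,y) is the coefficient of f_t(<x,y>) along e_xy; the rates are
   absolute values and the jumps are signs, so their products are linear in the
   state.  Integrating the second equation from c_0(x,y) = phi y - phi x gives
   E c_t(x,y) = u(y,t) - u(x,t), and the first one becomes the wave equation.

   The averaged equations are Dynkin's formula E F(f_t) = F(f) + int_0^t E LF(f_v) dv.
   It is obtained jump by jump from the renewal identity
     P(first n+1 jumps = s b, tau_(n+1) <= t)
       = rate_b(s) int_0^t P(first n jumps = s, tau_n <= v < tau_(n+1)) dv,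
   a consequence of the exponential law of the holding time given the past.  A
   jump raises the total rate by at most a constant, so the renewal identity also
   gives sum_n P(tau_n <= t) <= exp (C t): the process does not explode and its
   number of jumps has finite mean, which dominates all the functionals F. *)
Require Import Defs.
From HB Require Import structures.
From mathcomp Require Import all_boot all_order all_algebra.
From mathcomp Require Import all_classical all_reals all_analysis.
From mathcomp Require Import measurable_realfun.
From mathcomp Require Import lra ring.
Import Order.TTheory GRing.Theory Num.Theory.
Import numFieldNormedType.Exports.
Local Open Scope classical_set_scope.
Local Open Scope ring_scope.
Set Implicit Arguments. Unset Strict Implicit. Unset Printing Implicit Defensive.

(** * Primitives of locally Lipschitz functions *)

(** The law of the process is prescribed only on events that fix finitely many transitions and bound
    finitely many holding times from below; no filtration and no conditional law is given. So each
    clock must first be shown independent of the sum of the earlier ones, by a uniqueness argument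
    on a family stable under intersection, and then be started at that random time by
    discretisation. Holding times can be infinite (an absorbed state has total rate 0) and are
    positive only almost surely, hence the extended reals and the recurring null events. All
    functionals are functions of the finite list of transitions made so far, which lives in a
    countable type: measurability is automatic, and the state never has to be treated as a random
    element of a function space. Averages are first known as primitives of locally bounded
    functions, so they are locally Lipschitz; their integrands are finite linear combinations of
    such averages, hence Lipschitz in turn. This bootstrap turns the integral equations into
    derivatives at every time, one-sided at 0. *)

Definition locally_lipschitz {R : realType} (h : R -> R) := forall T, 0 <= T ->
  exists2 L, 0 <= L & forall s t, 0 <= s <= T -> 0 <= t <= T -> `|h s - h t| <= L * `|s - t|.

Lemma locally_lipschitz_sum {R : realType} {I : Type} (r : seq I) (a : I -> R)
    (h : I -> R -> R) : (forall i, locally_lipschitz (h i)) ->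
  locally_lipschitz (fun t => \sum_(i <- r) a i * h i t).
Proof.
move=> hl T T0; elim: r => [|i r [L L0 IH]].
  by exists 0 => // s t _ _; rewrite !big_nil subrr normr0 mul0r.
have [Li Li0 hi] := hl i T T0; exists (`|a i| * Li + L) => [|s t sT tT].
  by rewrite addr_ge0 // mulr_ge0.
rewrite !big_cons opprD addrACA mulrDl (le_trans (ler_normD _ _)) // lerD ?IH //.
by rewrite -mulrBr normrM -mulrA ler_wpM2l // hi.
Qed.

Lemma locally_lipschitzB {R : realType} (g h : R -> R) :
  locally_lipschitz g -> locally_lipschitz h -> locally_lipschitz (fun t => g t - h t).
Proof.
move=> gl hl T T0; have [L L0 gL] := gl T T0; have [L' L'0 hL] := hl T T0.
exists (L + L') => [|s t sT tT]; first exact: addr_ge0.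
have -> : g s - h s - (g t - h t) = (g s - g t) - (h s - h t) by ring.
by rewrite mulrDl (le_trans (ler_normB _ _)) // lerD ?gL ?hL.
Qed.

Section primitives.
Context {R : realType}.
Notation leb := (@lebesgue_measure R).
Variables (H g : R -> R) (c : R).
Hypothesis ig : forall t, 0 <= t -> leb.-integrable `[0, t] (EFin \o g).
Hypothesis Hg : forall t, 0 <= t -> H t = c + \int[leb]_(v in `[0, t]) g v.

(** One estimate serves twice: [a = 0] gives the Lipschitz bound of [primitive_lipschitz], and
    [a = g t] with [B] proportional to the length of the interval gives the quadratic error needed
    in [primitive_deriv]. *)
Lemma primitive_near_affine (s t a B : R) : 0 <= s -> s <= t ->
  (forall v, s <= v <= t -> `|g v - a| <= B) ->
  `|H t - H s - a * (t - s)| <= B * (t - s).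
Proof.
move=> s0 st gB; have t0 := le_trans s0 st.
pose D : set R := `]s, t]%classic.
have mD : measurable D by exact: measurable_itv.
have DT : D `<=` `[0, t].
  move=> v; rewrite /D /= !in_itv /= => /andP[sv vt].
  by rewrite vt andbT (le_trans s0) // ltW.
have igD : leb.-integrable D (EFin \o g).
  by apply: (@integrableS _ _ _ leb `[0, t]%classic D) => //; exact: ig.
have lD : fine (leb D) = t - s.
  rewrite /D lebesgue_measure_itv /= lte_fin; case: ltP => [_|ts].
    by rewrite -EFinB.
  by rewrite (le_anti (introT andP (conj st ts))) subrr.
have lDfin : (leb D < +oo)%E.
  by rewrite /D lebesgue_measure_itv /=; case: ifP => _; rewrite ?ltry // -EFinB ltry.
have icst (r : R) : leb.-integrable D (EFin \o (fun=> r)).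
  apply: measurable_bounded_integrable => //.
  by exists `|r|; split => // M rM v _ /=; exact: ltW.
have -> : H t - H s = \int[leb]_(v in D) g v.
  rewrite !Hg // opprD addrACA subrr add0r.
  by rewrite (Rintegral_itvB (ig t0)) // bnd_simp.
have -> : a * (t - s) = \int[leb]_(v in D) a by rewrite Rintegral_cst // lD.
rewrite -(RintegralB _ igD (icst a)) //.
have isub : leb.-integrable D (EFin \o (fun v => g v - a)).
  rewrite (_ : _ \o _ = ((EFin \o g) \- (EFin \o (fun=> a)))%E) //.
  by apply: integrableB => //; exact: icst.
apply: le_trans (le_normr_Rintegral _ isub) _ => //.
have -> : B * (t - s) = \int[leb]_(v in D) B by rewrite Rintegral_cst // lD.
apply: (le_Rintegral _ (integrable_norm isub) (icst B)) => //.
move=> v; rewrite /D /= in_itv /= => /andP[sv vt]; apply: gB.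
by rewrite ltW.
Qed.

Lemma primitive_lipschitz :
  (forall T, 0 <= T -> exists B, forall v, 0 <= v <= T -> `|g v| <= B) ->
  locally_lipschitz H.
Proof.
move=> gb T T0; have [B gB] := gb T T0.
have B0 : 0 <= B by apply: le_trans (gB 0 _); rewrite ?lexx.
exists B => // s t.
have main u v : 0 <= u -> u <= v -> v <= T -> `|H v - H u| <= B * (v - u).
  move=> u0 uv vT; have := @primitive_near_affine u v 0 B u0 uv.
  rewrite mul0r subr0; apply => w /andP[uw wv]; rewrite subr0 gB //.
  by rewrite (le_trans u0 uw) (le_trans wv vT).
move=> /andP[s0 sT] /andP[t0 tT]; have [st|/ltW ts] := leP s t.
  by rewrite distrC [X in _ <= _ * X]distrC [X in _ <= _ * X]ger0_norm ?subr_ge0 // main.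
by rewrite [X in _ <= _ * X]ger0_norm ?subr_ge0 // main.
Qed.

Lemma primitive_deriv : locally_lipschitz g -> deriv_nonneg H g.
Proof.
move=> gl t t0; apply/cvgrPdist_le => eps e0.
have [L L0 gL] := gl (t + 1) (addr_ge0 t0 ler01).
(* The bound 1 keeps [s] inside [[0, t + 1]], where [L] is valid; the other bound makes
   [L * |s - t|] at most [eps], with [L + 1] because [L] may be 0. *)
pose del := Num.min 1 (eps / (L + 1)).
have L1 : 0 < L + 1 by rewrite ltr_wpDl.
have del0 : 0 < del by rewrite lt_min ltr01 divr_gt0.
apply/nbhs_ballP; exists del => // s; rewrite -ball_normE /= lt_min => /andP[st1 ste] [s0 st].
have sT : s <= t + 1.
  by rewrite -lerBlDl (le_trans (ler_norm _)) // distrC ltW.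
have key : `|H s - H t - g t * (s - t)| <= (L * `|s - t|) * `|s - t|.
  have gv v : 0 <= v <= t + 1 -> `|v - t| <= `|s - t| -> `|g v - g t| <= L * `|s - t|.
    move=> vT vs; apply: (le_trans (gL v t vT _)); first by rewrite t0 lerDl ler01.
    exact: ler_wpM2l.
  have [ts|/ltW ts] := leP t s.
    have st0 : 0 <= s - t by rewrite subr_ge0.
    rewrite [X in _ <= _ * X]ger0_norm //; apply: primitive_near_affine => // v /andP[tv vs].
    apply: gv; first by rewrite (le_trans t0 tv) (le_trans vs).
    by rewrite !ger0_norm ?subr_ge0 // lerD2r.
  have ts0 : 0 <= t - s by rewrite subr_ge0.
  rewrite (_ : H s - H t - g t * (s - t) = - (H t - H s - g t * (t - s))); last by ring.
  rewrite normrN [X in _ <= _ * X]distrC [X in _ <= _ * X]ger0_norm //.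
  apply: primitive_near_affine => // v /andP[sv vt].
  apply: gv; first by rewrite (le_trans s0 sv) (le_trans vt) // lerDl ler01.
  by rewrite distrC [`|s - t|]distrC !ger0_norm ?subr_ge0 // lerD2l lerN2.
have sn : 0 < `|s - t| by rewrite normr_gt0 subr_eq0.
have -> : g t - (H s - H t) / (s - t) = - ((H s - H t - g t * (s - t)) / (s - t)).
  by field; rewrite subr_eq0.
rewrite normrN normrM normfV ler_pdivrMr //; apply: le_trans key _.
apply: ler_wpM2r => //.
have : `|s - t| * (L + 1) <= eps by rewrite -ler_pdivlMr // distrC ltW.
by apply: le_trans; rewrite mulrC ler_wpM2l // lerDl.
Qed.

End primitives.

(** * Exponential clocks *)

Section exponential.
Context {R : realType}.

(** The sign of [q] is left free: a rate [q] gives the law of an exponential clock started at [s],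
    and [q = - C] gives [integral_expR_growth]. *)
Lemma integral_expR_itv (q s t : R) : s <= t ->
  (\int[lebesgue_measure]_(v in `[s, t]) (q * expR (- (q * (v - s))))%:E =
   (1 - expR (- (q * (t - s))))%:E)%E.
Proof.
rewrite le_eqVlt => /predU1P[<-|st].
  by rewrite set_itv1 integral_set1 subrr mulr0 oppr0 expR0 subrr.
pose F (v : R) : R := - expR (- (q * (v - s))).
have dF (v : R) : is_derive v 1 F (q * expR (- (q * (v - s)))).
  rewrite [F](_ : _ = - (expR \o (fun v => - (q * (v - s))))) //.
  have d1 : is_derive v 1 (fun v => - (q * (v - s))) (- q).
    rewrite [X in is_derive _ _ X _](_ : _ = (- q) *: (id - cst s)).
      apply: is_derive_eq.
      by rewrite subr0 /GRing.scale /= mulr1.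
    by apply/funext => x; rewrite !fctE /= /GRing.scale /= mulNr.
  have d2 := @is_derive1_comp _ expR (fun v => - (q * (v - s))) v _ _
    (is_derive_expR _) d1.
  apply: is_derive_eq.
  by rewrite mulrN opprK mulrC.
have cont (g : R -> R) : (forall v, derivable g v 1) -> continuous g.
  by move=> dg v; apply/differentiable_continuous/derivable1_diffP/dg.
rewrite (@continuous_FTC2 _ _ F)//.
- rewrite /F subrr mulr0 oppr0 expR0 -EFinD opprK addrC //.
- apply: continuous_subspaceT; apply: cont => v.
  rewrite [X in derivable X](_ : _ = (- q) *: F); first by apply: derivableZ; apply: ex_derive.
  by apply/funext => x; rewrite !fctE /F /GRing.scale /= mulrNN.
- split; first by move=> v _; apply: ex_derive.
  + apply: cvg_at_right_filter; apply: (cont F) => v; exact: ex_derive.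
  + apply: cvg_at_left_filter; apply: (cont F) => v; exact: ex_derive.
- by move=> v _; rewrite derive1E; apply: derive_val.
Qed.

(** This replaces a passage to the limit in the grid width: if [y < x], an integer above
    [|q x / (x - y)|] contradicts the hypothesis. *)
Lemma ler_harmonic_scale (q x y : R) :
  (forall N, (1 - q / N.+1%:R) * x <= y) -> x <= y.
Proof.
move=> h; rewrite leNgt; apply/negP => yx.
have xy0 : 0 < x - y by rewrite subr_gt0.
have /andP[_ hN] := truncn_itv (normr_ge0 ((q * x) / (x - y))).
have := h (Num.Def.truncn `|q * x / (x - y)|); rewrite mulrBl mul1r lerBlDl -lerBlDr mulrAC.
apply/negP; rewrite -ltNge ltr_pdivrMr // [ltRHS]mulrC -ltr_pdivrMr //.
exact: le_lt_trans (ler_norm _) hN.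
Qed.

End exponential.

(** * Survival of an exponential clock started at a random time *)

Section freezing.
Local Open Scope ereal_scope.
Context {R : realType} {d} {Omega : measurableType d} (P : probability Omega R).
Variables (D E : set Omega) (sigma xi : Omega -> \bar R) (j q : R).
Hypotheses (mD : measurable D) (mE : measurable E).
Hypotheses (msigma : measurable_fun setT sigma) (mxi : measurable_fun setT xi).
Hypotheses (j0 : (0 <= j)%R) (q0 : (0 <= q)%R).
Hypothesis sigma0 : forall w, D w -> 0 <= sigma w.
Hypothesis indep : forall X (u : R), measurable X -> (0 <= u)%R ->
  P (D `&` sigma @^-1` X `&` E `&` [set w | u%:E < xi w]) =
  (j * expR (- (q * u)))%:E * P (D `&` sigma @^-1` X).

Let S v := D `&` [set w | sigma w <= v%:E].
(** Given [sigma], this is the conditional probability that a clock of rate [q] started at time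
    [sigma w] still runs at time [v]. *)
Let h v w := (expR (- (q * (v - fine (sigma w)))))%:E.

Let mS v : measurable (S v).
Proof.
apply: measurableI => //; rewrite -[X in measurable X]setTI.
exact: emeasurable_fun_infty_c.
Qed.

Let mh v A : measurable A -> measurable_fun A (h v).
Proof.
move=> mA; apply/measurable_EFinP; apply: measurableT_comp => //.
apply: measurableT_comp => //; apply: measurable_funM => //.
apply: measurable_funB => //; apply: measurableT_comp; first exact: fine_measurable.
exact: measurable_funTS.
Qed.

Let mray v : measurable [set w | v%:E < sigma w + xi w].
Proof.
rewrite -[X in measurable X]setTI; apply: emeasurable_fun_o_infty => //.
exact: emeasurable_funD.
Qed.

(* Squeeze: on each cell of a grid of width [1 / N.+1] for [sigma], replacing
   [sigma] by an end point of the cell costs a factor at most [exp (q / N.+1)]. *)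
Lemma freezing (v : R) : (0 <= v)%R ->
  P (S v `&` E `&` [set w | v%:E < sigma w + xi w]) =
  j%:E * \int[P]_(w in S v) h v w.
Proof.
move=> v0; set L := P _; set I := \int[P]_(w in S v) _.
have I0 : 0 <= I by apply: integral_ge0 => w _; rewrite lee_fin expR_ge0.
have I1 : I <= 1.
  apply: (@le_trans _ _ (\int[P]_(w in S v) cst 1 w)).
    apply: ge0_le_integral => //.
    - by move=> w _; rewrite lee_fin expR_ge0.
    - exact: mh.
    move=> w [Dw /= sv]; rewrite /h lee_fin -[leRHS]expR0 ler_expR oppr_le0.
    rewrite mulr_ge0 // subr_ge0 -lee_fin fineK //.
    by rewrite ge0_fin_numE ?sigma0 // (le_lt_trans sv) ?ltry.
  by rewrite integral_cst // mul1e probability_le1.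
have Ifin : I \is a fin_num by rewrite ge0_fin_numE // (le_lt_trans I1) ?ltry.
have mL : measurable (S v `&` E `&` [set w | v%:E < sigma w + xi w]).
  by apply: measurableI => //; apply: measurableI.
have Lfin : L \is a fin_num by apply: fin_num_measure.
(* Half-open cells are disjoint, and cutting them at [v] makes their union exactly [S v]. *)
pose X N i : set \bar R := [set` `[(i%:R / N.+1%:R)%:E, (i.+1%:R / N.+1%:R)%:E[ ]
  `&` [set` `]-oo, v%:E] ].
pose F N i := D `&` sigma @^-1` X N i.
have mX N i : measurable (X N i) by apply: measurableI; apply: emeasurable_itv.
have mF N i : measurable (F N i).
  by apply: measurableI => //; rewrite -[X in measurable X]setTI; exact: msigma.
have FE N i w : F N i w <-> [/\ D w, sigma w \is a fin_num,
   (i%:R / N.+1%:R <= fine (sigma w))%R, (fine (sigma w) < i.+1%:R / N.+1%:R)%R &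
   (fine (sigma w) <= v)%R].
  rewrite /F /X /preimage /=; split.
    move=> [Dw []]; rewrite !in_itv /= => /andP[a b] c.
    have sf : sigma w \is a fin_num by rewrite ge0_fin_numE ?sigma0// (le_lt_trans c) ?ltry.
    by split => //; rewrite -?lee_fin -?lte_fin fineK.
  by move=> [Dw sf a b c]; split => //; rewrite !in_itv /= -(fineK sf) !lee_fin lte_fin a b.
have Fcover N : \bigcup_i F N i = S v.
  apply/seteqP; split => [w [i _ /FE[Dw sf _ _ sv]]|w [Dw /= sv]].
    by split => //=; rewrite -(fineK sf) lee_fin.
  have sf : sigma w \is a fin_num by rewrite ge0_fin_numE ?sigma0// (le_lt_trans sv) ?ltry.
  have s0 : (0 <= fine (sigma w))%R by rewrite fine_ge0 ?sigma0.
  have /truncn_itv/andP[a b] : (0 <= fine (sigma w) * N.+1%:R)%R by rewrite mulr_ge0.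
  exists (Num.Def.truncn (fine (sigma w) * N.+1%:R)%R) => //; apply/FE; split => //.
  - by rewrite ler_pdivrMr.
  - by rewrite ltr_pdivlMr.
  - by rewrite -lee_fin fineK.
have Ftriv N : trivIset setT (F N).
  apply/trivIsetP => i k _ _ ik; apply/seteqP; split => // w [/FE[_ _ a b _] /FE[_ _ a' b' _]].
  have lt1 i' k' : (i'%:R / N.+1%:R <= fine (sigma w))%R ->
      (fine (sigma w) < k'.+1%:R / N.+1%:R)%R -> (i' <= k')%N.
    move=> /le_lt_trans h1 /h1; rewrite ltr_pM2r ?invr_gt0 // ltr_nat //.
  by move/eqP: ik; apply; apply/eqP; rewrite eqn_leq (lt1 _ _ a b') (lt1 _ _ a' b).
pose L' N i := P (F N i `&` E `&` [set w | v%:E < sigma w + xi w]).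
pose I' N i := \int[P]_(w in F N i) h v w.
have LE N : L = \sum_(i <oo) L' N i.
  rewrite /L -(Fcover N) !setI_bigcupl measure_semi_bigcup //.
  - by move=> i; apply: measurableI => //; apply: measurableI.
  - apply/trivIsetP => i k _ _ ik.
    have /trivIsetP /(_ i k Logic.I Logic.I ik) FF := Ftriv N.
    apply/seteqP; split => // w [[[Fi _] _] [[Fk _] _]].
    by rewrite -FF.
  - by apply: bigcupT_measurable => i; apply: measurableI => //; apply: measurableI.
have IE N : I = \sum_(i <oo) I' N i.
  rewrite /I -(Fcover N) (ge0_integral_bigcup P (mF N)) //.
  - by rewrite Fcover; exact: mh.
  - by move=> w _; rewrite lee_fin expR_ge0.
have L'0 N i : 0 <= L' N i by apply: measure_ge0.
have I'0 N i : 0 <= I' N i by apply: integral_ge0 => w _; rewrite lee_fin expR_ge0.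
have mray' u : measurable [set w | u%:E < xi w].
  by rewrite -[X in measurable X]setTI; apply: emeasurable_fun_o_infty.
pose dl N : R := (q * N.+1%:R^-1)%R.
have cst_int N i c : \int[P]_(w in F N i) (cst c%:E) w = c%:E * P (F N i).
  by rewrite integral_cst.
have iS (N i : nat) : (i.+1%:R / N.+1%:R = i%:R / N.+1%:R + N.+1%:R^-1 :> R)%R.
  by rewrite -natr1 mulrDl mul1r.
(* A clock longer than [v] minus the left end of the cell outlasts [v] from any starting time in the
   cell; starting times in a cell differ by at most [1 / N.+1], which is the loss [dl N] in the
   exponent. *)
have lower N i : (expR (- dl N) * j)%:E * I' N i <= L' N i.
  pose u : R := Order.max 0%R (v - i%:R / N.+1%:R)%R.
  have u0 : (0 <= u)%R by rewrite le_max lexx.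
  apply: (@le_trans _ _ (P (F N i `&` E `&` [set w | u%:E < xi w]))); last first.
    apply: le_measure; rewrite ?inE; [by apply: measurableI => //; apply: measurableI..|].
    move=> w [[Fw Ew] /= uw]; split => //=; move/FE : Fw => [Dw sf a b c].
    rewrite -(fineK sf) -lteBlDl// -EFinB (le_lt_trans _ uw) // lee_fin.
    by rewrite le_max; apply/orP; right; rewrite lerB.
  rewrite indep // EFinM [leRHS](_ : _ = j%:E * ((expR (- (q * u)))%:E * P (F N i))); last first.
    by rewrite EFinM muleA.
  rewrite [_ * j%:E]muleC -muleA; apply: lee_wpmul2l; first by rewrite lee_fin.
  rewrite -ge0_integralZl //; last 2 first.
  - exact: mh.
  - by move=> w _; rewrite lee_fin expR_ge0.
  rewrite -cst_int; apply: ge0_le_integral => //.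
  - by move=> w _; rewrite mule_ge0 // lee_fin expR_ge0.
  - by apply: emeasurable_funM => //; exact: mh.
  - move=> w /FE[Dw sf a b c]; rewrite /h -EFinM lee_fin -expRD ler_expR.
    rewrite -opprD lerN2 /dl -mulrDr ler_wpM2l // ge_max.
    have iN : (0 <= N.+1%:R^-1 :> R)%R by rewrite invr_ge0.
    rewrite addr_ge0 ?subr_ge0 //=; move: b; rewrite iS.
    by move: (i%:R / N.+1%:R : R)%R (N.+1%:R^-1 : R)%R => x y; lra.
have upper N i : (expR (- dl N))%:E * L' N i <= j%:E * I' N i.
  (* The right end of the last cell may lie beyond [v]; the truncation at 0 keeps [u] admissible in
     [indep]. *)
  pose u : R := Order.max 0%R (v - i.+1%:R / N.+1%:R)%R.
  have u0 : (0 <= u)%R by rewrite le_max lexx.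
  apply: (@le_trans _ _ ((expR (- dl N))%:E * P (F N i `&` E `&` [set w | u%:E < xi w]))).
    apply: lee_wpmul2l; first by rewrite lee_fin expR_ge0.
    apply: le_measure; rewrite ?inE; [by apply: measurableI => //; apply: measurableI..|].
    move=> w [[Fw Ew] /= uw]; split => //=; move/FE : Fw => [Dw sf a b c].
    rewrite -(fineK sf) -lteBlDl// -EFinB in uw; rewrite (le_lt_trans _ uw) // lee_fin.
    by rewrite ge_max subr_ge0 c lerB // ltW.
  rewrite indep // [leLHS](_ : _ =
      j%:E * ((expR (- dl N) * expR (- (q * u)))%:E * P (F N i))); last first.
    by rewrite muleA -EFinM muleA -EFinM; congr (_%:E * _); ring.
  apply: lee_wpmul2l; first by rewrite lee_fin.
  rewrite -cst_int; apply: ge0_le_integral => //.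
  - by move=> w _; rewrite lee_fin mulr_ge0 ?expR_ge0.
  - exact: mh.
  - move=> w /FE[Dw sf a b c]; rewrite /h lee_fin -expRD ler_expR.
    rewrite -opprD lerN2 /dl -mulrDr ler_wpM2l // -lerBlDl le_max.
    apply/orP; right; rewrite iS; move: a.
    by move: (i%:R / N.+1%:R : R)%R (N.+1%:R^-1 : R)%R => x y; lra.
(* The factor [expR (- dl N)] is at least [1 - q / N.+1], so the harmonic form of the limit
   applies. *)
have lim x y : 0 <= x -> x \is a fin_num -> y \is a fin_num ->
    (forall N, (expR (- dl N))%:E * x <= y) -> x <= y.
  move=> x0 xf yf xy; rewrite -(fineK xf) -(fineK yf) lee_fin.
  apply: (@ler_harmonic_scale _ q) => N; have := xy N.
  rewrite -{1}(fineK xf) -{1}(fineK yf) -EFinM lee_fin; apply: le_trans.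
  apply: ler_wpM2r; first exact: fine_ge0.
  exact: expR_ge1Dx.
have jI : j%:E * I \is a fin_num by rewrite fin_numM.
apply/eqP; rewrite eq_le; apply/andP; split.
  apply: lim => //; first exact: measure_ge0.
  move=> N; rewrite (LE N) (IE N) -!nneseriesZl //.
  by apply: lee_nneseries => // i _ _; rewrite mule_ge0 // lee_fin expR_ge0.
apply: lim => //; first by rewrite mule_ge0.
move=> N; rewrite muleA -EFinM (LE N) (IE N) -!nneseriesZl //.
by apply: lee_nneseries => // i _ _; rewrite mule_ge0 // lee_fin mulr_ge0 // expR_ge0.
Qed.

End freezing.

(** * Measurability of slices and the renewal identity *)

Section slices.
Local Open Scope ereal_scope.
Context {R : realType} {d d'} {S : measurableType d'} {Omega : measurableType d}.

Lemma measurable_slice (P : probability Omega R) (A : set (S * Omega)) :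
  measurable A -> measurable_fun setT (fun v => P [set w | A (v, w)]).
Proof.
move=> mA; rewrite (_ : (fun v => _) = P \o xsection A).
  exact: measurable_fun_xsection.
by apply/funext => v /=; congr (P _); apply/seteqP; split => w; rewrite /xsection /= inE.
Qed.

Lemma measurable_le2 (s : Omega -> \bar R) : measurable_fun setT s ->
  measurable [set x : R * Omega | s x.2 <= x.1%:E].
Proof.
move=> ms; rewrite -[X in measurable X]setTI; apply: measurable_lee => //.
- exact: measurableT_comp.
- exact/measurable_EFinP.
Qed.

End slices.

Section renewal.
Local Open Scope ereal_scope.
Context {R : realType} {d} {Omega : measurableType d} (P : probability Omega R).
Variables (D E : set Omega) (sigma xi : Omega -> \bar R) (j q : R).
Hypotheses (mD : measurable D) (mE : measurable E).
Hypotheses (msigma : measurable_fun setT sigma) (mxi : measurable_fun setT xi).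
Hypotheses (j0 : (0 <= j)%R) (q0 : (0 <= q)%R).
Hypothesis sigma0 : forall w, D w -> 0 <= sigma w.
Hypothesis indep_mark : forall X (u : R), measurable X -> (0 <= u)%R ->
  P (D `&` sigma @^-1` X `&` E `&` [set w | u%:E < xi w]) =
  (j * expR (- (q * u)))%:E * P (D `&` sigma @^-1` X).
Hypothesis indep : forall X (u : R), measurable X -> (0 <= u)%R ->
  P (D `&` sigma @^-1` X `&` [set w | u%:E < xi w]) =
  (expR (- (q * u)))%:E * P (D `&` sigma @^-1` X).

(** Among the paths with [sigma <= t] and mark [E], either the clock has rung by [t] or it has not.
    The second part is given by [freezing], the two together by [indep_mark] at level 0, so the
    first is the integral of [j * (1 - h t w)]. The condition [0 < xi w] stays in the event because
    the law controls only clocks above a nonnegative level. *)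
Lemma renewal (t : R) : (0 <= t)%R ->
  P (D `&` E `&` [set w | 0 < xi w] `&` [set w | sigma w + xi w <= t%:E]) =
  (j * q)%:E * \int[lebesgue_measure]_(v in `[0%R, t])
    P (D `&` [set w | sigma w <= v%:E] `&` [set w | v%:E < sigma w + xi w]).
Proof.
move=> t0; pose S v := D `&` [set w | sigma w <= v%:E].
pose h v w := (expR (- (q * (v - fine (sigma w)))))%:E.
have h0 v w : 0 <= h v w by rewrite lee_fin expR_ge0.
have mS v : measurable (S v).
  apply: measurableI => //; rewrite -[X in measurable X]setTI.
  exact: emeasurable_fun_infty_c.
have mh v A : measurable A -> measurable_fun A (h v).
  move=> mA; apply/measurable_EFinP; apply: measurableT_comp => //.
  apply: measurableT_comp => //; apply: measurable_funM => //.
  apply: measurable_funB => //; apply: measurableT_comp; first exact: fine_measurable.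
  exact: measurable_funTS.
have Sfin v w : S v w -> sigma w \is a fin_num.
  by move=> [Dw /= sv]; rewrite ge0_fin_numE ?sigma0 // (le_lt_trans sv) ?ltry.
have mle : measurable [set w | sigma w + xi w <= t%:E].
  rewrite -[X in measurable X]setTI; apply: emeasurable_fun_infty_c => //.
  exact: emeasurable_funD.
have mlt : measurable [set w | t%:E < sigma w + xi w].
  rewrite -[X in measurable X]setTI; apply: emeasurable_fun_o_infty => //.
  exact: emeasurable_funD.
have mpos : measurable [set w | 0 < xi w].
  by rewrite -[X in measurable X]setTI; apply: emeasurable_fun_o_infty.
have SE v : S v = D `&` sigma @^-1` [set` `]-oo, v%:E] ].
  by apply/seteqP; split => w [Dw] /=; rewrite in_itv /=.
set A := _ `&` [set w | sigma w + xi w <= t%:E].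
have mA : measurable A by apply: measurableI => //; apply: measurableI => //; apply: measurableI.
pose B := S t `&` E `&` [set w | t%:E < sigma w + xi w].
have mB : measurable B by apply: measurableI => //; apply: measurableI.
have AB : A `|` B = S t `&` E `&` [set w | 0%R%:E < xi w].
  apply/seteqP; split=> w /=.
    case=> [[[[Dw Ew] /= xi0] st]|[[St Ew] tx]].
      split => //; split => //; split => //=; rewrite (le_trans _ st) //.
      by rewrite leeDl // ltW.
    split => //; move: (Sfin _ _ St) (St.2) tx => sf /= + .
    rewrite -(fineK sf) lee_fin => st tx; rewrite ltNge; apply/negP => xi0.
    move: tx; apply/negP; rewrite -leNgt.
    apply: (@le_trans _ _ (fine (sigma w))%:E); last by rewrite lee_fin.
    by rewrite geeDl.
  move=> [[St Ew] /= xi0]; have [le|gt] := leP (sigma w + xi w) t%:E.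
    by left; split => //; split => //; split => //; exact: St.1.
  by right.
have PAB : P A + P B = j%:E * P (S t).
  rewrite -measureU //; last first.
    by apply/seteqP; split => // w [[_ /= le] [_ /=]]; rewrite ltNge le.
  rewrite AB SE (_ : j%:E = (j * expR (- (q * 0)))%:E); last first.
    by rewrite mulr0 oppr0 expR0 mulr1.
  by apply: (indep_mark (u := 0%R)) => //; exact: emeasurable_itv.
have PB : P B = j%:E * \int[P]_(w in S t) h t w.
  by rewrite /B (freezing mD mE msigma mxi j0 q0 sigma0 indep_mark).
have hle v w : S v w -> h v w <= 1.
  move=> Sv; rewrite /h lee_fin -[leRHS]expR0 ler_expR oppr_le0 mulr_ge0 // subr_ge0.
  by rewrite -lee_fin fineK ?(Sfin _ _ Sv) //; exact: Sv.2.
have g0 w : S t w -> 0 <= 1 - h t w.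
  by move=> Sw; rewrite sube_ge0 // ?hle //; apply/orP; right.
have mg : measurable_fun (S t) (fun w => 1 - h t w).
  by apply: emeasurable_funB => //; exact: mh.
have Ig : \int[P]_(w in S t) (1 - h t w) + \int[P]_(w in S t) h t w = P (S t).
  rewrite -ge0_integralD //; last exact: mh.
  rewrite -[RHS]mul1e -integral_cst //; apply: eq_integral => w _.
  by rewrite subeK.
(* [1 - h t w] is the integral over [[sigma w, t]] of the exponential density; after exchanging the
   integrals, the density at [v] is [q] times a survival probability, which [freezing] evaluates. *)
suff Iq : q%:E * \int[lebesgue_measure]_(v in `[0%R, t])
    P (S v `&` [set w | v%:E < sigma w + xi w]) = \int[P]_(w in S t) (1 - h t w).
  have PBfin : P B \is a fin_num by rewrite fin_num_measure.
  rewrite EFinM -muleA Iq -[LHS](addeK _ PBfin) PAB -Ig ge0_muleDr //; last 2 first.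
  - exact: integral_ge0.
  - exact: integral_ge0.
  by rewrite -PB addeK.
pose C : set (R * Omega) := [set x | [/\ (0 <= x.1 <= t)%R, D x.2 & sigma x.2 <= x.1%:E]].
have mC : measurable C.
  rewrite (_ : C = (`[0%R, t]%classic `*` D) `&` [set x | sigma x.2 <= x.1%:E]); last first.
    apply/seteqP; split => -[v w] /=; rewrite in_itv /=; first by case.
    by case=> -[].
  apply: measurableI; first exact: measurableX.
  exact: measurable_le2.
pose f (x : R * Omega) := (q * expR (- (q * (x.1 - fine (sigma x.2)))) * \1_C x)%:E.
have f0 x : 0 <= f x by rewrite lee_fin !mulr_ge0 ?expR_ge0.
have mf : measurable_fun setT f.
  apply/measurable_EFinP; apply: measurable_funM; last exact: measurable_indic.
  apply: measurable_funM => //; apply: measurableT_comp => //.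
  apply: measurableT_comp => //; apply: measurable_funM => //.
  apply: measurable_funB => //; apply: measurableT_comp; first exact: fine_measurable.
  exact: measurableT_comp.
transitivity (\int[lebesgue_measure]_v \int[P]_w f (v, w)).
  rewrite -ge0_integralZl //; last first.
    apply: measurable_funTS.
    apply: (@measurable_slice _ _ _ _ _ P
      [set x : R * Omega | S x.1 x.2 /\ x.1%:E < sigma x.2 + xi x.2]).
    rewrite (_ : [set x | _] = ((setT `*` D) `&` [set x | sigma x.2 <= x.1%:E]) `&`
        ~` [set x | sigma x.2 + xi x.2 <= x.1%:E]).
      apply: measurableI.
        by apply: measurableI; [apply: measurableX|exact: measurable_le2].
      apply: measurableC; apply: (@measurable_le2 _ _ _ (fun w => sigma w + xi w)).
      exact: emeasurable_funD.
    apply/seteqP; split => -[v w] /=.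
      by move=> [[? ?]]; rewrite ltNge => /negP.
    by move=> [[[_ ?] ?]] /negP; rewrite -ltNge.
  rewrite integral_mkcond; apply: eq_integral => v _; rewrite /patch.
  case: ifPn => [|vt].
    rewrite inE /= in_itv /= => /andP[v0 vt].
    (* Mark event [setT] and [j = 1]: the clock is followed whatever the next mark is. *)
    have := @freezing _ _ _ P D setT sigma xi 1 q mD measurableT msigma mxi ler01 q0 sigma0.
    move=> /(_ _ v v0); rewrite setIT => ->; last first.
      by move=> X u mX u0; rewrite setIT mul1r indep.
    rewrite mul1e -ge0_integralZl //; [|exact: mS|exact: (mh _ _ (mS v))].
    rewrite integral_mkcond; apply: eq_integral => w _; rewrite /patch /f indicE.
    case: ifPn => [|wS].
      rewrite inE => Sw; rewrite mem_set ?mulr1 //.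
      by split => //=; rewrite ?v0 //; [exact: Sw.1|exact: Sw.2].
    rewrite memNset ?mulr0 // => -[_ /= Dw sw].
    by move/negP : wS; apply; rewrite inE; split.
  apply/esym/integral0_eq => w _; rewrite /f indicE memNset ?mulr0 // => -[/= v0t _ _].
  by move/negP : vt; apply; rewrite inE /= in_itv.
transitivity (\int[P]_w \int[lebesgue_measure]_v f (v, w)).
  exact: (@fubini_tonelli _ _ _ _ _ lebesgue_measure P f mf f0).
rewrite [RHS]integral_mkcond; apply: eq_integral => w _.
rewrite /patch; case: ifPn => [|wS].
  rewrite inE => Sw; have sf := Sfin _ _ Sw.
  have st : (fine (sigma w) <= t)%R by rewrite -lee_fin fineK //; exact: Sw.2.
  have s0 : (0 <= fine (sigma w))%R by rewrite fine_ge0 // sigma0 //; exact: Sw.1.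
  rewrite /h -EFinB -(integral_expR_itv _ st) [RHS]integral_mkcond.
  apply: eq_integral => v _; rewrite /f indicE /patch; case: ifPn => [|vt].
    rewrite inE /= in_itv /= => /andP[sv vt]; rewrite mem_set ?mulr1 //.
    split => //=; [by rewrite vt (le_trans s0)|exact: Sw.1|].
    by rewrite -(fineK sf) lee_fin.
  rewrite memNset ?mulr0 // => -[/= /andP[_ vt'] Dw sv].
  move/negP : vt; apply; rewrite inE /= in_itv /= vt' andbT.
  by rewrite -lee_fin fineK.
apply: integral0_eq => v _; rewrite /f indicE memNset ?mulr0 // => -[/= /andP[_ vt] Dw sv].
move/negP : wS; apply; rewrite inE; split => //=; by rewrite (le_trans sv) ?lee_fin.
Qed.
End renewal.

(** * Independence from the past, extended from thresholds to jump times *)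

Section past.
Local Open Scope ereal_scope.
Context {R : realType} {d} {Omega : measurableType d} (P : probability Omega R).
Variable xi : nat -> Omega -> \bar R.
Hypothesis mxi : forall n, measurable_fun setT (xi n).

(** The shape of the clock events on which [is_IPS] prescribes the law. With nonnegative thresholds
    they form a family stable under intersection, taking the maximum of the thresholds. *)
Definition above n (ts : nat -> R) : set Omega :=
  [set w | forall i, (i < n)%N -> (ts i)%:E < xi i w].

Lemma measurable_above n ts : measurable (above n ts).
Proof.
rewrite (_ : above n ts = \bigcap_(i in `I_n) [set w | (ts i)%:E < xi i w]).
  apply: bigcap_measurableType => i _; rewrite -[X in measurable X]setTI.
  exact: emeasurable_fun_o_infty.
by apply/seteqP; split => w wts i; exact: wts.
Qed.

Lemma measurable_tau n : measurable_fun setT (tau xi n).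
Proof. by apply: emeasurable_sum => i; exact: mxi. Qed.

Lemma measurable_tau_le n (t : R) : measurable [set w | tau xi n w <= t%:E].
Proof.
rewrite -[X in measurable X]setTI.
by apply: emeasurable_fun_infty_c => //; exact: measurable_tau.
Qed.

Lemma tauS n w : tau xi n.+1 w = tau xi n w + xi n w.
Proof. by rewrite /tau big_ord_recr. Qed.

Lemma above0_tau_ge0 n w : above n (fun=> 0%R) w -> 0 <= tau xi n w.
Proof. by move=> xi0; apply: sume_ge0 => i _; exact/ltW/xi0. Qed.

(* [setT] is included so that this intersection-stable family covers [Omega]. *)
Definition past_sets n : set (set Omega) :=
  [set A | A = setT \/ exists2 ts, (forall i, (0 <= ts i)%R) & A = above n ts].

(** Each clock, set to 0 outside [above n (fun=> 0)], is measurable for the generated sigma-algebra,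
    hence so is their finite sum; on that set the sum is [tau xi n]. *)
Lemma past_sets_tau n X : measurable X ->
  <<s past_sets n >> (above n (fun=> 0%R) `&` tau xi n @^-1` X).
Proof.
move=> mX; pose O : set Omega := above n (fun=> 0%R).
pose T : measurableType _ := g_sigma_algebraType (past_sets n).
have mO : measurable (O : set T).
  by apply: sub_sigma_algebra; right; exists (fun=> 0%R).
have mZ (i : 'I_n) : measurable_fun setT ((xi i \_ O) : T -> \bar R).
  apply: (measurability _ (ErealGenOInfty.measurableE R)) => // _ [_ [r ->] <-].
  (* For [r >= 0] the set is [above] with threshold [r] at [i] and 0 elsewhere. For [r < 0] it is
     the whole space, since the modified clock is 0 off [O] and positive on [O]. *)
  rewrite setTI; have [r0|r0] := leP 0%R r.
    apply: sub_sigma_algebra; right.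
    exists (fun k : nat => if k == i :> nat then r else 0%R) => [k|]; first by case: ifP.
    apply/seteqP; split => w /=; rewrite in_itv /= andbT /patch.
      case: ifPn; last by rewrite /= ltNge lee_fin r0.
      rewrite inE => Ow rw k kn; case: ifP => [/eqP ->//|_]; exact: Ow.
    move=> h; rewrite mem_set; first by have := h i (ltn_ord i); rewrite eqxx.
    move=> k kn; have := h k kn; case: ifP => // _; apply: le_lt_trans.
    by rewrite lee_fin.
  rewrite (_ : _ @^-1` _ = setT) //; apply/seteqP; split => // w _ /=.
  rewrite in_itv /= andbT /patch; case: ifPn => [|_]; last by rewrite lte_fin.
  rewrite inE => Ow; apply: lt_trans (Ow i (ltn_ord i)); rewrite lte_fin //.
have mtau : measurable_fun setT ((fun w => \sum_(i < n) (xi i \_ O) w) : T -> \bar R).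
  exact: emeasurable_sum.
suff -> : O `&` tau xi n @^-1` X = O `&` (fun w => \sum_(i < n) (xi i \_ O) w) @^-1` X.
  apply: (@measurableI _ T) => //.
  rewrite -[X in measurable X]setTI; exact: mtau.
apply/seteqP; split => w [Ow] /=; rewrite /tau;
  under eq_bigr do rewrite /patch mem_set //; by [].
Qed.

(** The two sides, as functions of the past event, are finite measures that agree on [past_sets n];
    uniqueness on a generating family stable under intersection carries the equality to events about
    [tau xi n]. *)
Lemma past_indep n (A B : set Omega) (c : R) :
  measurable A -> measurable B -> (0 <= c)%R ->
  (forall ts, (forall i, (0 <= ts i)%R) ->
    P (A `&` above n ts `&` B) = c%:E * P (A `&` above n ts)) ->
  forall X, measurable X ->
    P (A `&` above n (fun=> 0%R) `&` tau xi n @^-1` X `&` B) =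
    c%:E * P (A `&` above n (fun=> 0%R) `&` tau xi n @^-1` X).
Proof.
move=> mA mB c0 h X mX; pose O := above n (fun=> 0%R).
have mO : measurable O by exact: measurable_above.
have mAO : measurable (A `&` O) by exact: measurableI.
have mAOB : measurable (A `&` O `&` B) by exact: measurableI.
pose m1 : {measure set Omega -> \bar R} := mrestr P mAOB.
pose m2 : {measure set Omega -> \bar R} := mscale (NngNum c0) (mrestr P mAO).
have Oabove ts : (forall i, (0 <= ts i)%R) -> above n ts `&` O = above n ts.
  move=> ts0; apply: setIidl => w wts i lin; apply: le_lt_trans (wts i lin).
  by rewrite lee_fin.
have m1E Y : m1 Y = P (Y `&` (A `&` O `&` B)) by [].
have m2E Y : m2 Y = c%:E * P (Y `&` (A `&` O)) by [].
suff key : m1 (O `&` tau xi n @^-1` X) = m2 (O `&` tau xi n @^-1` X).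
  transitivity (m1 (O `&` tau xi n @^-1` X)).
    by congr (P _); apply/seteqP; split => w /=; rewrite /O; tauto.
  rewrite key; congr (_ * P _); apply/seteqP; split => w /=; rewrite /O; tauto.
apply: (@g_sigma_algebra_measure_unique _ R _ (past_sets n) _ (fun=> setT) _ _ m1 m2 _ _ _
  _ (@past_sets_tau n _ mX)).
- move=> Y [->//|[ts _ ->]]; exact: measurable_above.
- by left.
- by apply/seteqP; split => // w _; exists 0%N.
- move=> Y Z [->|[ts ts0 ->]]; first by rewrite setTI.
  move=> [->|[us us0 ->]]; first by rewrite setIT; right; exists ts.
  right; exists (fun i => Order.max (ts i) (us i)) => [i|]; first by rewrite le_max ts0.
  apply/seteqP; split => w.
    by move=> [wt wu] i lin; rewrite EFin_max gt_max wt // wu.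
  by move=> h'; split => i lin; have := h' i lin; rewrite EFin_max gt_max => /andP[].
- move=> Y [->|[ts ts0 ->]].
    rewrite m1E m2E !setTI; exact: h.
  rewrite m1E m2E; have := h _ ts0.
  rewrite (_ : A `&` above n ts `&` B = above n ts `&` (A `&` O `&` B)); last first.
    by rewrite -{1}(Oabove _ ts0); apply/seteqP; split => w /=; tauto.
  rewrite (_ : A `&` above n ts = above n ts `&` (A `&` O)) //.
  by rewrite -{1}(Oabove _ ts0); apply/seteqP; split => w /=; tauto.
- move=> _; rewrite m1E setTI; apply: (le_lt_trans (probability_le1 P mAOB)).
  exact: ltry.
Qed.

End past.

(** * Splitting along the values of a countably valued variable *)

Section fibers.
Local Open Scope ereal_scope.
Context {R : realType} {d} {Omega : measurableType d} (mu : {measure set Omega -> \bar R}).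
Context {C : countType} (X : Omega -> C).
Hypothesis mX : forall c, measurable [set w | X w = c].

(** Indexing by [pickle] turns the fibres into a sequence, so that countable additivity applies;
    codes that are not attained give empty sets. *)
Let F k := [set w | pickle (X w) = k].

Let F_or k : F k = set0 \/ exists c, F k = [set w | X w = c].
Proof.
have [->|/set0P[w Fw]] := eqVneq (F k) set0; first by left.
right; exists (X w); apply/seteqP; split => w' /=; rewrite /F /=.
  by move=> w'k; apply: (pcan_inj pickleK); rewrite w'k.
by move=> ->.
Qed.

Let mF k : measurable (F k).
Proof. by case: (F_or k) => [->|[c ->]]. Qed.

Let Fcover : \bigcup_k F k = setT.
Proof. by apply/seteqP; split => // w _; exists (pickle (X w)). Qed.

Let Ftriv : trivIset setT F.
Proof.
apply/trivIsetP => i k _ _ /eqP ik; apply/seteqP; split => // w [wi wk].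
by apply: ik; rewrite -wi -wk.
Qed.

Lemma measurable_countable_fun {d'} {T : measurableType d'} (g : C -> T) :
  measurable_fun setT (g \o X).
Proof.
move=> _ B mB; rewrite setTI.
rewrite (_ : _ @^-1` B = \bigcup_k (F k `&` [set w | B (g (X w))])).
  apply: bigcupT_measurable => k; case: (F_or k) => [->|[c ->]]; first by rewrite set0I.
  have [Bc|Bc] := pselect (B (g c)).
    rewrite (_ : _ `&` _ = [set w | X w = c]) //.
    by apply: setIidl => w /= ->.
  rewrite (_ : _ `&` _ = set0) //.
  by apply/seteqP; split => // w /= [->].
by apply/seteqP; split => [w Bw|w [k _ []//]]; exists (pickle (X w)).
Qed.

Lemma eq_integral_fibers (f g : Omega -> \bar R) :
  measurable_fun setT f -> measurable_fun setT g ->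
  (forall w, 0 <= f w) -> (forall w, 0 <= g w) ->
  (forall c, \int[mu]_(w in [set w | X w = c]) f w =
             \int[mu]_(w in [set w | X w = c]) g w) ->
  \int[mu]_w f w = \int[mu]_w g w.
Proof.
move=> mf mg f0 g0 fg; rewrite -Fcover !(ge0_integral_bigcup mu mF) //.
- by apply: eq_eseriesr => k _; case: (F_or k) => [->|[c ->]]; rewrite ?integral_set0.
- exact: measurable_funTS.
- exact: measurable_funTS.
Qed.

Lemma eq_measure_fibers (A B : set Omega) : measurable A -> measurable B ->
  (forall c, mu (A `&` [set w | X w = c]) = mu (B `&` [set w | X w = c])) ->
  mu A = mu B.
Proof.
move=> mA mB AB; rewrite -[A]setIT -[B]setIT -Fcover !setI_bigcupr.
have step D : measurable D -> mu (\bigcup_i (D `&` F i)) = \sum_(i <oo) mu (D `&` F i).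
  move=> mD; rewrite measure_semi_bigcup //.
  - by move=> i; exact: measurableI.
  - by apply: trivIset_setIl.
  - by apply: bigcupT_measurable => i; exact: measurableI.
rewrite !step //; apply: eq_eseriesr => k _.
by case: (F_or k) => [->|[c ->]]; rewrite ?setI0 ?measure0.
Qed.

End fibers.

(** * Sequences of marked exponential clocks *)

Lemma measure_mem_seq {R : realType} {d} {Omega : measurableType d}
    (mu : {measure set Omega -> \bar R}) {C : countType} (X : Omega -> C)
    (A : set Omega) (L : seq C) :
  measurable A -> (forall c, measurable [set w | X w = c]) -> uniq L ->
  (mu (A `&` [set w | X w \in L]) = \sum_(c <- L) mu (A `&` [set w | X w = c]))%E.
Proof.
move=> mA mX; elim: L => [_|b L IH /= /andP[bL /IH {}IH]].
  by rewrite big_nil (_ : _ `&` _ = set0) ?measure0 //; apply/seteqP; split => // w [].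
have mL : measurable [set w | X w \in L].
  elim: L {IH bL} => [|c L IH].
    by rewrite (_ : mkset _ = set0) //; apply/seteqP; split => // w.
  rewrite (_ : mkset _ = [set w | X w = c] `|` [set w | X w \in L]).
    exact: measurableU.
  apply/seteqP; split => w /=; rewrite inE; first by case/orP => [/eqP|]; [left|right].
  by case=> [->|->]; rewrite ?eqxx ?orbT.
rewrite big_cons -IH -measureU.
- rewrite -setIUr; congr (mu (_ `&` _)); apply/seteqP; split => w /=; rewrite inE.
    by case/orP => [/eqP|]; [left|right].
  by case=> [->|->]; rewrite ?eqxx ?orbT.
- exact: measurableI.
- exact: measurableI.
- by apply/seteqP; split => // w [[_ /= Xb] [_ /=]]; rewrite Xb (negbTE bL).
Qed.

Section marked.
Local Open Scope ereal_scope.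
Context {R : realType} {d} {Omega : measurableType d} (P : probability Omega R).
Context {M : countType}.
Variables (e : nat -> Omega -> M) (xi : nat -> Omega -> \bar R).

Definition marks n w : seq M := mkseq (e^~ w) n.

Lemma size_marks n w : size (marks n w) = n.
Proof. exact: size_mkseq. Qed.

Lemma marksS n w : marks n.+1 w = rcons (marks n w) (e n w).
Proof. by rewrite /marks /mkseq -addn1 iotaD map_cat cats1. Qed.

(** Positivity of the clocks is built in: it makes [tau] nonnegative and matches the form of
    [past_indep]. It costs only a null set, by [probability_above0]. *)
Definition cyl s : set Omega :=
  [set w | marks (size s) w = s] `&` above xi (size s) (fun=> 0%R).

(* Given the first [size s] marks [s] and clocks, the next mark is [b] with
   probability [J s b] and the next clock is independent of it, exponential of
   rate [Q s]. *)
Record marked_clocks (J : seq M -> M -> R) (Q : seq M -> R) : Prop := MarkedClocks {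
  mc_mark : forall n a, measurable [set w | e n w = a];
  mc_clock : forall n, measurable_fun setT (xi n);
  mc_J0 : forall s b, (0 <= J s b)%R;
  mc_Q0 : forall s, (0 <= Q s)%R;
  mc_J1 : forall s, exists L, uniq L /\ (\sum_(b <- L) J s b = 1)%R;
  mc_law : forall s b ts (u : R), (forall i, (0 <= ts i)%R) -> (0 <= u)%R ->
    P ([set w | marks (size s) w = s] `&` above xi (size s) ts `&`
       ([set w | e (size s) w = b] `&` [set w | u%:E < xi (size s) w])) =
    (J s b * expR (- (Q s * u)))%:E *
    P ([set w | marks (size s) w = s] `&` above xi (size s) ts) }.

Variables (J : seq M -> M -> R) (Q : seq M -> R).
Hypothesis HJQ : marked_clocks J Q.
Let me := mc_mark HJQ.
Let mxi := mc_clock HJQ.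
Let J0 := mc_J0 HJQ.
Let Q0 := mc_Q0 HJQ.

Lemma measurable_marks n s : measurable [set w | marks n w = s].
Proof.
elim: n s => [|n IH] s.
  have [->|s0] := eqVneq s [::].
    by rewrite (_ : mkset _ = setT) //; apply/seteqP; split.
  rewrite (_ : mkset _ = set0) //; apply/seteqP; split => // w /= s0'.
  by move: s0; rewrite -s0'.
case/lastP: s => [|s b].
  by rewrite (_ : mkset _ = set0) //; apply/seteqP; split.
rewrite (_ : mkset _ = [set w | marks n w = s] `&` [set w | e n w = b]).
  exact: measurableI.
apply/seteqP; split => w /=; rewrite marksS; first by move/rcons_inj => [].
by case=> -> ->.
Qed.

Lemma measurable_cyl s : measurable (cyl s).
Proof. by apply: measurableI; [exact: measurable_marks|exact: measurable_above]. Qed.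

Let mlt n (u : R) : measurable [set w | u%:E < xi n w].
Proof. by rewrite -[X in measurable X]setTI; apply: emeasurable_fun_o_infty. Qed.

Let mpre n X : measurable X -> measurable (tau xi n @^-1` X).
Proof.
by move=> mX; rewrite -[X in measurable X]setTI; apply: (measurable_tau mxi).
Qed.

Lemma mark_indep s b X (u : R) : measurable X -> (0 <= u)%R ->
  P (cyl s `&` tau xi (size s) @^-1` X `&` [set w | e (size s) w = b] `&`
     [set w | u%:E < xi (size s) w]) =
  (J s b * expR (- (Q s * u)))%:E * P (cyl s `&` tau xi (size s) @^-1` X).
Proof.
move=> mX u0; rewrite -setIA; apply: (past_indep mxi) => //.
- exact: measurable_marks.
- exact: measurableI.
- by rewrite mulr_ge0 ?expR_ge0.
- by move=> ts ts0; exact: (mc_law HJQ).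
Qed.

(** The law is known only jointly with the next mark, so it is summed over the finite list [L] that
    carries the whole mass of [J s]; marks outside [L] must then be shown negligible. *)
Lemma clock_indep s X (u : R) : measurable X -> (0 <= u)%R ->
  P (cyl s `&` tau xi (size s) @^-1` X `&` [set w | u%:E < xi (size s) w]) =
  (expR (- (Q s * u)))%:E * P (cyl s `&` tau xi (size s) @^-1` X).
Proof.
move=> mX u0; set n := size s; set B := cyl s `&` _.
have mB : measurable B by apply: measurableI; [exact: measurable_cyl|exact: mpre].
have [L [uL L1]] := mc_J1 HJQ s.
pose U (u : R) := B `&` [set w | u%:E < xi n w].
have mU v : measurable (U v) by exact: measurableI.
pose N := [set w | e n w \in L].
have mN : measurable N.
  rewrite (_ : N = \big[setU/set0]_(b <- L) [set w | e n w = b]).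
    exact: bigsetU_measurable.
  rewrite -bigcup_seq; apply/seteqP; split => w.
    by move=> wL; exists (e n w).
  by move=> [b bL /= eb]; rewrite /N /= eb.
have UL v : (0 <= v)%R -> P (U v `&` N) = (expR (- (Q s * v)))%:E * P B.
  move=> v0; rewrite measure_mem_seq //.
  rewrite (eq_bigr (fun b => (J s b)%:E * ((expR (- (Q s * v)))%:E * P B))); last first.
    by move=> b _; rewrite muleA -EFinM -(mark_indep _ _ mX v0) /U setIAC.
  rewrite -ge0_sume_distrl; last by move=> b _; rewrite lee_fin.
  by rewrite sumEFin L1 mul1e.
(* At [v = 0] the exponential factor is 1, so the part of [B] with mark in [L] already has the full
   measure of [B]. *)
have P0 : P (B `&` ~` N) = 0.
  apply/eqP; rewrite eq_le measure_ge0 andbT.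
  have PB : P B = P (B `&` N) + P (B `&` ~` N).
    rewrite -measureU ?setIUr -?setIUr ?setUv ?setIT //.
    - exact: measurableI.
    - by apply: measurableI => //; exact: measurableC.
    - by apply/seteqP; split => // w [[_ ?] [_ ?]].
  have PBN : P B <= P (B `&` N).
    rewrite [leLHS](_ : _ = P (U 0%R `&` N)); last first.
      by rewrite UL // mulr0 oppr0 expR0 mul1e.
    apply: le_measure; rewrite ?inE; [exact: measurableI..|].
    by move=> w [[]].
  have fBN : P (B `&` N) \is a fin_num by apply: fin_num_measure; exact: measurableI.
  by move: PBN; rewrite PB -leeBrDl// subee.
rewrite -UL // -/(U u).
have -> : P (U u) = P (U u `&` N) + P (U u `&` ~` N).
  rewrite -measureU -?setIUr ?setUv ?setIT //.
  - exact: measurableI.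
  - by apply: measurableI => //; exact: measurableC.
  - by apply/seteqP; split => // w [[_ ?] [_ ?]].
rewrite [X in _ + X](_ : _ = 0) ?adde0 //; apply/eqP; rewrite eq_le measure_ge0 andbT.
rewrite -P0; apply: le_measure; rewrite ?inE.
- by apply: measurableI => //; exact: measurableC.
- by apply: measurableI => //; exact: measurableC.
- by move=> w [[]].
Qed.

(** At level 0, [clock_indep] says that requiring one more positive clock loses no mass on any
    cylinder; the induction sums this over the histories. *)
Lemma probability_above0 n : P (above xi n (fun=> 0%R)) = 1.
Proof.
elim: n => [|n IH].
  by rewrite (_ : above _ _ _ = setT) ?probability_setT //; apply/seteqP; split.
transitivity (P (above xi n (fun=> 0%R))); last exact: IH.
apply: (@eq_measure_fibers _ _ _ P _ (marks n) (measurable_marks n)).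
- exact: measurable_above.
- exact: measurable_above.
move=> c; have [<-|/eqP nc] := eqVneq (size c) n; last first.
  by congr (P _); apply/seteqP; split => w [_ /= cw]; case: nc; rewrite -cw size_marks.
have := @clock_indep c setT 0%R measurableT (lexx _).
rewrite preimage_setT setIT mulr0 oppr0 expR0 mul1e => cl.
transitivity (P (cyl c)); last by rewrite /cyl setIC.
rewrite -cl; congr (P _); apply/seteqP; split => w /=.
  move=> [ab /= cw]; split; last exact: ab.
  by split => // i ic; apply: ab; rewrite ltnS ltnW.
move=> [[cw ab] xi0]; split => // i; rewrite ltnS leq_eqVlt => /predU1P[->//|]; exact: ab.
Qed.

Lemma probability_Iabove0 n A : measurable A -> P A = P (A `&` above xi n (fun=> 0%R)).
Proof.
move=> mA; have mab := measurable_above mxi n (fun=> 0%R).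
have nA : P (A `&` ~` above xi n (fun=> 0%R)) = 0.
  apply/eqP; rewrite eq_le measure_ge0 andbT.
  have <- : P (~` above xi n (fun=> 0%R)) = 0.
    by rewrite probability_setC // probability_above0 subee.
  by apply: le_measure; rewrite ?inE //; [apply: measurableI => //|]; exact: measurableC.
have -> : P A = P (A `&` above xi n (fun=> 0%R)) + P (A `&` ~` above xi n (fun=> 0%R)).
  rewrite -measureU -?setIUr ?setUv ?setIT //.
  - exact: measurableI.
  - by apply: measurableI => //; exact: measurableC.
  - by apply/seteqP; split => // w [[_ ?] [_ ?]].
by rewrite nA adde0.
Qed.

(* The times of [[0, t]] spent in the [n]-th holding interval. *)
Definition stay n (t : R) : set (R * Omega) :=
  [set x | [/\ (0 <= x.1 <= t)%R, tau xi n x.2 <= x.1%:E & x.1%:E < tau xi n.+1 x.2]].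

Lemma measurable_stay n t : measurable (stay n t).
Proof.
rewrite (_ : stay n t = (`[0%R, t]%classic `*` setT) `&`
   ([set x | tau xi n x.2 <= x.1%:E] `&` ~` [set x | tau xi n.+1 x.2 <= x.1%:E])).
  apply: measurableI; first exact: measurableX.
  apply: measurableI; first exact: (measurable_le2 (measurable_tau mxi n)).
  by apply: measurableC; exact: (measurable_le2 (measurable_tau mxi n.+1)).
apply/seteqP; split => -[v w] /=; rewrite in_itv /=.
  by move=> [a b c]; do 2 split => //; apply/negP; rewrite -ltNge.
by move=> [[a _] [b /negP]]; rewrite -ltNge.
Qed.

Lemma measurable_marks_stay n t (G : seq M -> R) :
  measurable_fun setT (fun x : R * Omega => (G (marks n x.2) * \1_(stay n t) x)%:E).
Proof.
apply/measurable_EFinP; apply: measurable_funM; last first.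
  by apply: measurable_indic; exact: measurable_stay.
apply: (measurableT_comp (f := G \o marks n)) => //.
exact: (measurable_countable_fun (measurable_marks n)).
Qed.

(** The renewal identity summed over histories of length [n]: on a fibre of [marks n] the quantities
    [j], [Q] and [G] are constants. It is shared by [mark_stay], where [B] fixes the next mark, and
    [clock_stay], where [B] is everything and [j = 1]. *)
Lemma stay_integral n (B : set Omega) (j G : seq M -> R) (t : R) :
  measurable B -> (forall s, 0 <= j s)%R -> (forall s, 0 <= G s)%R -> (0 <= t)%R ->
  (forall s X (u : R), size s = n -> measurable X -> (0 <= u)%R ->
    P (cyl s `&` tau xi n @^-1` X `&` B `&` [set w | u%:E < xi n w]) =
    (j s * expR (- (Q s * u)))%:E * P (cyl s `&` tau xi n @^-1` X)) ->
  \int[P]_w (G (marks n w) * \1_(B `&` [set w | (tau xi n.+1 w <= t%:E)%E]) w)%:E =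
  \int[P]_w \int[lebesgue_measure]_v
    ((j (marks n w) * Q (marks n w) * G (marks n w)) * \1_(stay n t) (v, w))%:E.
Proof.
move=> mB j0 G0 t0 jB; set S := B `&` _.
pose psi s := (j s * Q s * G s)%R.
have psi0 s : (0 <= psi s)%R by rewrite !mulr_ge0.
have mS : measurable S.
  apply: measurableI => //; rewrite -[X in measurable X]setTI.
  by apply: emeasurable_fun_infty_c => //; exact: measurable_tau.
have mK := measurable_marks_stay n t psi.
apply: (@eq_integral_fibers _ _ _ P _ (marks n) (measurable_marks n)).
- apply/measurable_EFinP; apply: measurable_funM; last exact: measurable_indic.
  exact: (measurable_countable_fun (measurable_marks n)).
- apply: (measurable_fun_fubini_tonelli_G (m1 := lebesgue_measure) _ mK) => x.
  by rewrite lee_fin mulr_ge0.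
- by move=> w; rewrite lee_fin mulr_ge0.
- by move=> w; apply: integral_ge0 => v _; rewrite lee_fin !mulr_ge0.
move=> c; have [nc|/eqP nc] := eqVneq (size c) n; last first.
  rewrite (_ : mkset _ = set0) ?integral_set0 //; apply/seteqP; split => // w /= cw.
  by case: nc; rewrite -cw size_marks.
set Ec := mkset _; have mEc : measurable Ec by exact: measurable_marks.
transitivity ((G c)%:E * P (S `&` Ec)).
  rewrite -integral_indic // -ge0_integralZl_EFin //; last first.
    by apply/measurable_EFinP/measurable_funTS/measurable_indic.
  by apply: eq_integral => w; rewrite inE /Ec /= => ->.
have -> : P (S `&` Ec) = P (cyl c `&` B `&` [set w | 0 < xi n w] `&`
    [set w | tau xi n w + xi n w <= t%:E]).
  (* Discarding a null set makes the first [n.+1] clocks positive, which supplies both the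
     positivity inside [cyl c] and the condition [0 < xi n w] of [renewal]. *)
  rewrite (probability_Iabove0 n.+1); last exact: measurableI.
  congr (P _); apply/seteqP; split => w.
    move=> [[[Bw /= tw] Ew] ab]; split; last by rewrite /= -tauS.
    split; last by apply: ab.
    split => //; rewrite /cyl nc; split => // i ic; apply: ab; rewrite ltnS; exact: ltnW.
  rewrite /cyl nc => -[[[[cw ab] Bw] xi0] tw].
  split; first by split => //; split => //=; rewrite tauS.
  by move=> i; rewrite ltnS leq_eqVlt => /predU1P[->//|]; exact: ab.
rewrite (@renewal _ _ _ P (cyl c) B (tau xi n) (xi n) (j c) (Q c)) //; last 5 first.
- exact: measurable_cyl.
- exact: measurable_tau.
- by move=> w [_]; rewrite nc; exact: above0_tau_ge0.
- by move=> X u mX u0; exact: jB.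
- by move=> X u mX u0; rewrite -nc; exact: clock_indep.
pose Wc := stay n t `&` (setT `*` Ec).
have mWc : measurable Wc by apply: measurableI; [exact: measurable_stay|exact: measurableX].
pose f x := (psi c * \1_Wc x)%:E.
have f0 x : 0 <= f x by rewrite lee_fin mulr_ge0.
have mf : measurable_fun setT f.
  by apply/measurable_EFinP; apply: measurable_funM => //; exact: measurable_indic.
transitivity (\int[P]_w \int[lebesgue_measure]_v f (v, w)); last first.
  rewrite [RHS]integral_mkcond; apply: eq_integral => w _; rewrite /patch.
  case: ifPn => [|wE].
    rewrite inE => Ew; apply: eq_integral => v _; rewrite /f Ew !indicE in_setI.
    by rewrite [X in _ && X]mem_set ?andbT.
  apply: integral0_eq => v _; rewrite /f indicE memNset ?mulr0 // => -[_ [_ /= Ew]].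
  by move/negP : wE; rewrite inE.
transitivity (\int[lebesgue_measure]_v \int[P]_w f (v, w)); last first.
  exact: (@fubini_tonelli _ _ _ _ _ lebesgue_measure P f mf f0).
have mWcv v : measurable [set w | Wc (v, w)].
  rewrite (_ : mkset _ = xsection Wc v); first exact: measurable_xsection.
  by apply/seteqP; split => w; rewrite /xsection /= inE.
transitivity ((psi c)%:E * \int[lebesgue_measure]_v P [set w | Wc (v, w)]).
  rewrite muleA -EFinM (_ : (G c * (j c * Q c) = psi c)%R); last first.
    by rewrite /psi mulrC.
  congr (_ * _); rewrite integral_mkcond; apply: eq_integral => v _; rewrite /patch.
  case: ifPn => [|vt].
    rewrite inE /= in_itv /= => vt; rewrite [RHS](probability_Iabove0 n) //.
    congr (P _); apply/seteqP; split => w; rewrite /cyl nc.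
      by move=> [[[cw ab] tw] vw]; split => //; split => //; split => //=; rewrite tauS.
    by move=> [[[/= _ tw vw] [_ Ew]] ab]; split; [|rewrite /= -tauS].
  rewrite [X in P X](_ : _ = set0) ?measure0 //; apply/seteqP; split => // w [[/= vt' _ _] _].
  by move/negP : vt; apply; rewrite inE /= in_itv.
rewrite -ge0_integralZl_EFin //; last exact: measurable_slice.
apply: eq_integral => v _; rewrite -[X in P X]setIT -integral_indic // -ge0_integralZl_EFin //.
by apply/measurable_EFinP; exact: measurable_indic.
Qed.

Let mtau_le n t := measurable_tau_le mxi n t.

Lemma mark_stay n b (G : seq M -> R) (t : R) : (forall s, 0 <= G s)%R -> (0 <= t)%R ->
  \int[P]_w (G (marks n w) *
    \1_([set w | e n w = b] `&` [set w | (tau xi n.+1 w <= t%:E)%E]) w)%:E =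
  \int[P]_w \int[lebesgue_measure]_v
    ((J (marks n w) b * Q (marks n w) * G (marks n w)) * \1_(stay n t) (v, w))%:E.
Proof.
move=> G0 t0; apply: (@stay_integral n _ (J^~ b)) => //.
by move=> s X u <- mX u0; exact: mark_indep.
Qed.

Lemma clock_stay n (t : R) : (0 <= t)%R ->
  P [set w | tau xi n.+1 w <= t%:E] =
  \int[P]_w \int[lebesgue_measure]_v (Q (marks n w) * \1_(stay n t) (v, w))%:E.
Proof.
move=> t0; rewrite -[X in P X]setTI -[X in P X]setIT -integral_indic //; last first.
  exact: measurableI.
transitivity (\int[P]_w (1 * \1_(setT `&` [set w | (tau xi n.+1 w <= t%:E)%E]) w)%:E).
  by apply: eq_integral => w _; rewrite mul1r.
rewrite (@stay_integral n setT (fun=> 1%R) (fun=> 1%R)) //; last first.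
  by move=> s X u <- mX u0; rewrite setIT mul1r; exact: clock_indep.
by apply: eq_integral => w _; apply: eq_integral => v _; rewrite mul1r mulr1.
Qed.

Lemma ae_clock_gt0 : {ae P, forall w, forall n, 0 < xi n w}.
Proof.
rewrite /prop_near1 /=; have : P.-negligible (\bigcup_n ~` above xi n (fun=> 0%R)).
  apply: negligible_bigcup => n; apply/negligibleP.
    by apply: measurableC; exact: measurable_above.
  have /= -> := probability_setC P (measurable_above mxi n (fun=> 0%R)).
  by rewrite probability_above0 subee.
apply: negligibleS => w /= /existsNP[n xin]; exists n.+1 => // ab.
by apply: xin; exact: ab.
Qed.

(** There are countably many histories, and each one followed by a mark of probability 0 is a null
    event by [mark_indep]. This lets increments be computed for possible transitions only. *)
Lemma ae_mark_neq0 : {ae P, forall w, forall n, J (marks n w) (e n w) != 0%R}.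
Proof.
rewrite /prop_near1 /=.
pose Z n := [set w | J (marks n w) (e n w) = 0%R].
have mZ n : measurable (Z n).
  (* [g] splits off the last mark of [marks n.+1 w]; its value on the empty list is arbitrary, that
     list never having length [n.+1]. *)
  pose g (s : seq M) : R := if s is b :: s' then J (belast b s') (last b s') else 1%R.
  have := measurable_countable_fun (measurable_marks n.+1) g.
  move=> /(_ measurableT [set 0%R] (measurable_set1 _)); rewrite setTI.
  rewrite (_ : _ @^-1` _ = Z n) //; apply/seteqP.
  by split => w; rewrite /preimage /Z /mkset /comp /set1 marksS /g;
    case: (marks n w) => [|c s] //=; rewrite ?belast_rcons ?last_rcons.
have PZ n : P (Z n) = 0.
  rewrite (probability_Iabove0 n.+1) //; transitivity (P set0); last exact: measure0.
  apply: (@eq_measure_fibers _ _ _ P _ (marks n.+1) (measurable_marks n.+1)) => //.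
    by apply: measurableI => //; exact: measurable_above.
  have null X : X = set0 -> P X = 0 by move=> ->; exact: measure0.
  move=> c; rewrite set0I measure0; case/lastP: c => [|s b].
    by apply: null; apply/seteqP; split => // w [].
  have [Jsb|/eqP Jsb] := eqVneq (J s b) 0%R; last first.
    apply: null.
    apply/seteqP; split => // w [[Zw _] /=]; rewrite marksS => /rcons_inj[sw bw].
    by apply: Jsb; rewrite -sw -bw.
  have [ns|ns] := eqVneq (size s) n; last first.
    apply: null.
    apply/seteqP; split => // w [_ /=]; rewrite marksS => /rcons_inj[sw bw].
    by move: ns; rewrite -sw size_marks eqxx.
  apply/eqP; rewrite eq_le measure_ge0 andbT.
  have := @mark_indep s b setT 0%R measurableT (lexx _).
  rewrite preimage_setT setIT Jsb mul0r mul0e => <-.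
  apply: le_measure; rewrite ?inE.
  - apply: measurableI; last exact: measurable_marks.
    by apply: measurableI => //; exact: measurable_above.
  - do 2 (apply: measurableI => //); exact: measurable_cyl.
  - move=> w [[_ ab] /=]; rewrite marksS => /rcons_inj[sw bw].
    split; last by rewrite /= ns; apply: ab.
    split; last by rewrite /= ns.
    by split; rewrite ns // => i ic; apply: ab; rewrite ltnS; exact: ltnW.
have : P.-negligible (\bigcup_n Z n).
  by apply: negligible_bigcup => n; apply/negligibleP => //; exact: PZ.
apply: negligibleS => w /= /existsNP[n /negP]; rewrite negbK => /eqP Jn.
by exists n.
Qed.

End marked.

(** * Non-explosion *)

(** Summation by parts; the boundary term [N%:R * a N] is nonnegative. *)
Lemma weighted_decrease_le {R : realDomainType} (a : nat -> R) N :
  (forall n, 0 <= a n) ->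
  \sum_(n < N) n.+1%:R * (a n - a n.+1) <= \sum_(n < N) a n.
Proof.
move=> a0; suff -> : \sum_(n < N) a n =
    \sum_(n < N) n.+1%:R * (a n - a n.+1) + N%:R * a N by rewrite lerDl mulr_ge0.
elim: N => [|N IH]; first by rewrite !big_ord0 mul0r addr0.
rewrite !big_ord_recr /= IH -[N.+1%:R]natr1; ring.
Qed.

Lemma integral_expR_growth {R : realType} (C t : R) : 0 <= C -> 0 <= t ->
  (\int[lebesgue_measure]_(v in `[0%R, t]) (C * expR (C * v))%:E = (expR (C * t) - 1)%:E)%E.
Proof.
move=> C0 t0; have := integral_expR_itv (- C) t0.
rewrite subr0 mulNr opprK => IC; apply: oppe_inj.
rewrite -integral_ge0N; last by move=> v _; rewrite lee_fin mulr_ge0 ?expR_ge0.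
rewrite -EFinN opprB -IC; apply: eq_integral => v _.
by rewrite subr0 !mulNr opprK.
Qed.

(** * Jump times and jump counts along one trajectory *)

Section paths.
Local Open Scope ereal_scope.
Context {R : realType} {d} {Omega : measurableType d}.
Variable xi : nat -> Omega -> \bar R.

Lemma tau_homo w : (forall n, 0 < xi n w) ->
  {homo (fun n => tau xi n w) : n k / (n <= k)%N >-> n <= k}.
Proof.
move=> xi0; apply: homo_leq; first exact: lexx.
  by move=> ? ? ?; exact: le_trans.
move=> n; rewrite tauS leeDl //; exact/ltW/xi0.
Qed.

Lemma tau_le_eta (t : R) w : (forall n, 0 < xi n w) -> (0 <= t)%R ->
  (exists n, t%:E < tau xi n w) ->
  forall n, (tau xi n w <= t%:E) = (n <= Defs.eta xi t w)%N.
Proof.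
move=> xi0 t0 ex; have [m tm mmin] := ex_minnP ex.
have m0 : (0 < m)%N.
  by rewrite lt0n; apply: contraTneq tm => ->; rewrite /tau big_ord0 -leNgt lee_fin.
have le n : (tau xi n w <= t%:E) = (n <= m.-1)%N.
  apply/idP/idP => [tn|nm].
    rewrite -ltnS prednK // ltnNge; apply/negP => mn.
    by have := lt_le_trans tm (tau_homo xi0 mn); rewrite ltNge tn.
  rewrite leNgt; apply/negP => /mmin; rewrite leqNgt => /negP; apply.
  by rewrite -(prednK m0) ltnS.
move=> n; rewrite le; congr (_ <= _)%N; apply/esym; rewrite /Defs.eta.
case: xgetP => [k -> [/= tk kmax]|/(_ m.-1) []].
  by apply/eqP; rewrite eqn_leq -le tk kmax // le.
by split; [rewrite le|move=> n'; rewrite le].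
Qed.

Lemma measurable_eta (mxi : forall n, measurable_fun setT (xi n)) n :
  measurable [set x : R * Omega | Defs.eta xi x.1 x.2 = n].
Proof.
pose D k := [set x : R * Omega | tau xi k x.2 <= x.1%:E /\
  forall n', tau xi n' x.2 <= x.1%:E -> (n' <= k)%N].
have mle k : measurable [set x : R * Omega | tau xi k x.2 <= x.1%:E].
  exact: (measurable_le2 (measurable_tau mxi k)).
have mD k : measurable (D k).
  rewrite (_ : D k = [set x | tau xi k x.2 <= x.1%:E] `&`
     \bigcap_(n' in [set n' | (k < n')%N]) ~` [set x | tau xi n' x.2 <= x.1%:E]).
    apply: measurableI => //; apply: bigcap_measurableType => n' _.
    by apply: measurableC; exact: mle.
  apply/seteqP; split => x /= [tx h]; split => //.
    by move=> n' /= kn' /h; rewrite leqNgt kn'.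
  by move=> n' tn'; rewrite leqNgt; apply/negP => /h.
have etaP x k : D k x -> Defs.eta xi x.1 x.2 = k.
  move=> [tk kmax]; rewrite /Defs.eta; case: xgetP => [l -> [/= tl lmax]|/(_ k) []//].
  by apply/eqP; rewrite eqn_leq kmax // lmax.
rewrite (_ : mkset _ = D n `|` (if n == 0%N then ~` (\bigcup_k D k) else set0)).
  apply: measurableU => //; case: ifP => // _; apply: measurableC.
  exact: bigcupT_measurable.
apply/seteqP; split => x /=.
  have [[k Dk]|nD] := pselect (exists k, D k x).
    by rewrite (etaP _ _ Dk) => <-; left.
  rewrite /Defs.eta; case: xgetP => [l _ Dl _|_ <-]; first by (case: nD; exists l).
  by right; rewrite eqxx => -[k _ Dk]; case: nD; exists k.
case=> [/etaP//|]; case: ifPn => // /eqP -> nD; rewrite /Defs.eta.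
by case: xgetP => // l _ Dl; case: nD; exists l.
Qed.

End paths.

Section nonexplosion.
Local Open Scope ereal_scope.
Context {R : realType} {d} {Omega : measurableType d} (P : probability Omega R).
Context {M : countType}.
Variables (e : nat -> Omega -> M) (xi : nat -> Omega -> \bar R).
Variables (J : seq M -> M -> R) (Q : seq M -> R) (C : R).
Hypothesis HJQ : marked_clocks P e xi J Q.
Hypothesis C0 : (0 <= C)%R.
Hypothesis QC : forall s, (Q s <= C * (size s).+1%:R)%R.
Let mxi := mc_clock HJQ.
Let Q0 := mc_Q0 HJQ.

Let mtau_le n t := measurable_tau_le mxi n t.

Let a n (t : R) : R := fine (P [set w | tau xi n w <= t%:E]).

Let aE n t : (a n t)%:E = P [set w | tau xi n w <= t%:E].
Proof. by rewrite /a fineK // fin_num_measure. Qed.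

Let a0 n t : (0 <= a n t)%R.
Proof. by rewrite /a fine_ge0. Qed.

Let ma n : measurable_fun setT (a n).
Proof.
apply/measurable_EFinP; rewrite (_ : EFin \o _ = fun t => P [set w | tau xi n w <= t%:E]).
  apply: (@measurable_slice _ _ _ _ _ P [set x : R * Omega | tau xi n x.2 <= x.1%:E]).
  exact: (measurable_le2 (measurable_tau mxi n)).
by apply/funext => t /=; rewrite aE.
Qed.

(** During the [n]-th holding interval the history has length [n], so the rate is at most
    [C * n.+1]; the probability of being in that interval at time [v] is [a n v - a n.+1 v]. *)
Lemma tau_prob_step n (t : R) : (0 <= t)%R ->
  P [set w | tau xi n.+1 w <= t%:E] <=
  \int[lebesgue_measure]_(v in `[0%R, t]) (C * (n.+1%:R * (a n v - a n.+1 v)))%:E.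
Proof.
move=> t0; rewrite (clock_stay HJQ) //.
pose f x := ((C * n.+1%:R) * \1_(stay xi n t) x)%:E.
have f0 x : 0 <= f x by rewrite lee_fin !mulr_ge0.
have mf : measurable_fun setT f.
  apply/measurable_EFinP; apply: measurable_funM => //.
  by apply: measurable_indic; exact: (measurable_stay HJQ).
have mK := measurable_marks_stay HJQ n t Q.
apply: (@le_trans _ _ (\int[P]_w \int[lebesgue_measure]_v f (v, w))).
  apply: ge0_le_integral => //.
  - by move=> w _; apply: integral_ge0 => v _; rewrite lee_fin mulr_ge0.
  - apply: (measurable_fun_fubini_tonelli_G (m1 := lebesgue_measure) _ mK) => x.
    by rewrite lee_fin mulr_ge0.
  - exact: (measurable_fun_fubini_tonelli_G (m1 := lebesgue_measure) _ mf).
  move=> w _; apply: ge0_le_integral => //.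
  - by move=> v _; rewrite lee_fin mulr_ge0.
  - exact: (measurableT_comp mK (pair2_measurable w)).
  - exact: (measurableT_comp mf (pair2_measurable w)).
  by move=> v _; rewrite lee_fin ler_wpM2r // (le_trans (QC _)) // size_marks.
rewrite [leLHS](_ : _ = \int[lebesgue_measure]_v \int[P]_w f (v, w)); last first.
  exact/esym/(@fubini_tonelli _ _ _ _ _ lebesgue_measure P f mf f0).
rewrite [leRHS]integral_mkcond le_eqVlt; apply/orP; left; apply/eqP.
apply: eq_integral => v _; rewrite /patch; case: ifPn => [|vt]; last first.
  apply: integral0_eq => w _; rewrite /f indicE memNset ?mulr0 // => -[/= vt' _ _].
  by move/negP : vt; apply; rewrite inE /= in_itv.
rewrite inE /= in_itv /= => vt.
transitivity ((C * n.+1%:R)%:E * P ([set w | tau xi n w <= v%:E] `\`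
    [set w | tau xi n.+1 w <= v%:E])).
  rewrite -[X in P X]setIT -integral_indic //; last exact: measurableD.
  rewrite -ge0_integralZl_EFin ?mulr_ge0 //; last first.
    by apply/measurable_EFinP; apply: measurable_indic; exact: measurableD.
  apply: eq_integral => w _; rewrite /f -EFinM; congr (_ * _)%:E.
  rewrite !indicE; congr (_ %:R); congr nat_of_bool; apply/idP/idP; rewrite !inE.
    by move=> [_ /= a1 a2]; split => //=; apply/negP; rewrite -ltNge.
  by move=> [/= a1 /negP]; rewrite -ltNge.
rewrite mulrA [in RHS]EFinM; congr (_ * _); rewrite EFinB !aE.
set A := [set w | tau xi n w <= v%:E]; set B := [set w | tau xi n.+1 w <= v%:E].
(* The inclusion of [B] in [A] holds only where the clocks are positive, hence up to a null set. *)
have -> : P B = P (B `&` A).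
  have mB : measurable B by exact: mtau_le.
  have mBA : measurable (B `&` A) by apply: measurableI => //; exact: mtau_le.
  rewrite (probability_Iabove0 HJQ n.+1 mB) (probability_Iabove0 HJQ n.+1 mBA).
  congr (P _); apply/seteqP; split => w /=; last by move=> [[]].
  move=> [Bw ab]; split => //; split => //=; apply: le_trans Bw.
  by rewrite tauS leeDl // ltW // ab.
rewrite (setIC B); apply: measureD; [exact: mtau_le..|].
by rewrite (le_lt_trans (probability_le1 P _)) ?ltry //; exact: mtau_le.
Qed.

(* With rates growing linearly in [n], Abel summation bounds the weighted sum of
   the occupation probabilities by the same partial sum one index lower, so the
   bound is Gronwall's inequality by plain induction on [N]. *)
Lemma tau_prob_sum N (t : R) : (0 <= t)%R ->
  \sum_(n < N) P [set w | tau xi n w <= t%:E] <= (expR (C * t))%:E.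
Proof.
elim: N t => [|N IH] t t0; first by rewrite big_ord0 lee_fin expR_ge0.
rewrite big_ord_recl /=.
have b0 n v : (0 <= a n v - a n.+1 v)%R.
  rewrite subr_ge0 -lee_fin !aE (probability_Iabove0 HJQ n.+1) //.
  apply: le_measure; rewrite ?inE //.
    by apply: measurableI => //; exact: measurable_above.
  move=> w [/= Bw ab]; apply: le_trans Bw; by rewrite tauS leeDl // ltW // ab.
(* The term [n = 0] is at most 1; the shifted terms are bounded by the integral of
   [C * expR (C * v)] over [[0, t]]. *)
apply: (@le_trans _ _ (1 + (expR (C * t) - 1)%:E)); last by rewrite -EFinD addrC subrK.
apply: leeD; first exact: probability_le1.
apply: (@le_trans _ _ (\sum_(n < N) \int[lebesgue_measure]_(v in `[0%R, t])
    (C * (n.+1%:R * (a n v - a n.+1 v)))%:E)).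
  by apply: lee_sum => n _; exact: tau_prob_step.
have mterm n : measurable_fun `[0%R, t]%classic
    (fun v => (C * (n.+1%:R * (a n v - a n.+1 v)))%:E).
  apply/measurable_EFinP/measurable_funTS; apply: measurable_funM => //.
  by apply: measurable_funM => //; apply: measurable_funB; exact: ma.
rewrite -ge0_integral_sum //; last 2 first.
- by move=> n; exact: mterm.
- by move=> n v _; rewrite lee_fin !mulr_ge0.
rewrite -integral_expR_growth //; apply: ge0_le_integral => //.
- by move=> v _; apply: sume_ge0 => n _; rewrite lee_fin !mulr_ge0.
- by apply: emeasurable_sum => n; exact: mterm.
- apply/measurable_EFinP/measurable_funTS; apply: measurable_funM => //.
  by apply: measurableT_comp => //; exact: measurable_funM.
move=> v; rewrite /= in_itv /= => /andP[v0 _].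
rewrite sumEFin lee_fin -mulr_sumr ler_wpM2l //.
apply: le_trans (weighted_decrease_le _ (fun n => a0 n v)) _.
by rewrite -lee_fin -sumEFin; under eq_bigr do rewrite aE; exact: IH.
Qed.

(** If all jump times were at most [t] with probability [p > 0], every partial sum in [tau_prob_sum]
    would be at least [N * p], which is unbounded in [N]. *)
Lemma ae_nonexplosion (t : R) : (0 <= t)%R ->
  {ae P, forall w, exists n, t%:E < tau xi n w}.
Proof.
move=> t0; rewrite /prop_near1 /=.
pose Z := \bigcap_n [set w | tau xi n w <= t%:E].
have mZ : measurable Z by exact: bigcapT_measurable.
have PZ : P Z = 0.
  apply/eqP; rewrite eq_le measure_ge0 andbT -(fineK (fin_num_measure P _ mZ)) lee_fin.
  rewrite leNgt; apply/negP => p0; set p := fine _ in p0.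
  have /andP[_ hN] := truncn_itv (normr_ge0 (expR (C * t) / p)%R).
  set N := (Num.Def.truncn _).+1 in hN.
  have : (N%:R * p)%:E <= (expR (C * t))%:E.
    apply: le_trans (tau_prob_sum N t0); rewrite mulr_natl -[N in leLHS]card_ord.
    rewrite -sumr_const -sumEFin; apply: lee_sum => n _.
    rewrite fineK ?fin_num_measure //; apply: le_measure; rewrite ?inE //.
    by move=> w; apply.
  rewrite lee_fin -ler_pdivlMr // leNgt => /negP; apply.
  exact: le_lt_trans (ler_norm _) hN.
apply: (@negligibleS _ _ _ _ Z); last by apply/negligibleP => //; exact: PZ.
move=> w /= /forallNP h n _ /=; rewrite leNgt; apply/negP; exact: h.
Qed.

End nonexplosion.

(** * Dynkin formula *)

Lemma nneseries_finite_support {R : realType} (f : nat -> \bar R) N :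
  (forall n, 0 <= f n)%E -> (forall n, (N <= n)%N -> f n = 0%E) ->
  (\sum_(n <oo) f n = \sum_(n < N) f n)%E.
Proof.
move=> f0 fN; rewrite (nneseries_split 0%N N) // add0n big_mkord.
by rewrite eseries0 ?adde0 // => n Nn _; exact: fN.
Qed.

Lemma integral_probability_cst {R : realType} {d} {Omega : measurableType d}
    (P : probability Omega R) (k : R) : (\int[P]_w k%:E = k%:E)%E.
Proof.
rewrite (integral_cst P measurableT) [X in (_ * X)%E](_ : _ = 1%E) ?mule1 //.
exact: probability_setT.
Qed.

Section dynkin.
Local Open Scope ereal_scope.
Context {R : realType} {d} {Omega : measurableType d} (P : probability Omega R).
Context {M : countType}.
Variables (e : nat -> Omega -> M) (xi : nat -> Omega -> \bar R).
Variables (J : seq M -> M -> R) (Q : seq M -> R) (C : R).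
Hypothesis HJQ : marked_clocks P e xi J Q.
Hypothesis C0 : (0 <= C)%R.
Hypothesis QC : forall s, (Q s <= C * (size s).+1%:R)%R.
Let me := mc_mark HJQ.
Let mxi := mc_clock HJQ.
Let J0 := mc_J0 HJQ.
Let Q0 := mc_Q0 HJQ.
Notation leb := (@lebesgue_measure R).

(** The list of all marks up to time [t], rather than the current state: every function of it is
    measurable, and increments can be summed along it. *)
Definition history (t : R) w : seq M := marks e (Defs.eta xi t w) w.

Lemma size_history t w : size (history t w) = Defs.eta xi t w.
Proof. exact: size_marks. Qed.

Lemma measurable_history2 (G : seq M -> R) :
  measurable_fun setT (fun x : R * Omega => G (history x.1 x.2)).
Proof.
apply: (measurable_countable_fun (X := fun x : R * Omega => history x.1 x.2)) => s.
rewrite (_ : mkset _ = [set x | Defs.eta xi x.1 x.2 = size s] `&`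
    (setT `*` [set w | marks e (size s) w = s])).
  apply: measurableI; first exact: measurable_eta.
  by apply: measurableX => //; exact: (measurable_marks HJQ).
apply/seteqP; split => -[v w] /=; rewrite /history.
  move=> es; have ns : Defs.eta xi v w = size s by rewrite -es size_marks.
  by split => //; split => //; rewrite -ns.
by move=> [-> [_ ->]].
Qed.

Lemma measurable_history (t : R) (G : seq M -> R) :
  measurable_fun setT (fun w => G (history t w)).
Proof. exact: (measurableT_comp (measurable_history2 G) (pair1_measurable t)). Qed.

Lemma ae_regular (t : R) : (0 <= t)%R ->
  {ae P, forall w, [/\ forall n, 0 < xi n w, forall n, J (marks e n w) (e n w) != 0%R &
    exists n, t%:E < tau xi n w]}.
Proof.
move=> t0; have := ae_nonexplosion HJQ C0 QC t0.
have := ae_mark_neq0 HJQ; have := ae_clock_gt0 HJQ.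
by apply: filterS3 => w; split.
Qed.

Let mtau_le n t := measurable_tau_le mxi n t.

(** Almost surely the number of jumps is the sum over [n] of the indicators of [tau xi n.+1 w <= t],
    and [tau_prob_sum] bounds the mean of every partial sum. *)
Lemma integral_eta_le (t : R) : (0 <= t)%R ->
  \int[P]_w (Defs.eta xi t w)%:R%:E <= (expR (C * t))%:E.
Proof.
move=> t0.
have mI n : measurable_fun setT (fun w => (\1_[set w | (tau xi n.+1 w <= t%:E)%E] w)%:E : \bar R).
  by apply/measurable_EFinP; exact: measurable_indic.
rewrite (@ge0_ae_eq_integral _ _ _ P setT _
  (fun w => \sum_(n <oo) (\1_[set w | (tau xi n.+1 w <= t%:E)%E] w)%:E)) //; last 4 first.
- apply/measurable_EFinP; have := measurable_history t (fun s => (size s)%:R).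
  by under eq_fun do rewrite size_history.
- exact: ge0_emeasurable_sum.
- by move=> w _; rewrite nneseries_ge0.
- have := ae_regular t0; apply: filterS => w [xi0 _ ex] _.
  have le := tau_le_eta xi0 t0 ex.
  rewrite (nneseries_finite_support (N := Defs.eta xi t w)) //; last first.
    by move=> n Nn; rewrite indicE memNset // /mkset le; apply/negP; rewrite -ltnNge ltnS.
  rewrite (eq_bigr (fun=> 1)); last first.
    by move=> n _; rewrite indicE mem_set // /mkset le.
  by rewrite sumEFin sumr_const card_ord.
rewrite integral_nneseries //.
apply: lime_le; first by apply: is_cvg_nneseries => n _ _; exact: integral_ge0.
near=> N; rewrite big_mkord; apply: le_trans (tau_prob_sum HJQ C0 QC N.+1 t0).
rewrite big_ord_recl /=; under eq_bigr do rewrite integral_indic // setIT.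
by rewrite leeDr.
Unshelve. all: by end_near. Qed.

(** Domination by the number of jumps; with [integral_eta_le] it makes means finite and bounded on
    bounded time intervals. *)
Definition linear_growth (G : seq M -> R) :=
  exists2 c, (0 <= c)%R & forall s, (`|G s| <= c * (size s).+1%:R)%R.

Lemma linear_growthD G H : linear_growth G -> linear_growth H ->
  linear_growth (fun s => G s + H s)%R.
Proof.
move=> [c c0 Gc] [c' c'0 Hc]; exists (c + c')%R => [|s]; first exact: addr_ge0.
by rewrite mulrDl (le_trans (ler_normD _ _)) // lerD.
Qed.

Lemma linear_growthZ (k : R) G : linear_growth G -> linear_growth (fun s => k * G s)%R.
Proof.
move=> [c c0 Gc]; exists (`|k| * c)%R => [|s]; first exact: mulr_ge0.
by rewrite normrM -mulrA ler_wpM2l.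
Qed.

Lemma linear_growth_sum I (r : seq I) (G : I -> seq M -> R) :
  (forall i, linear_growth (G i)) -> linear_growth (fun s => \sum_(i <- r) G i s)%R.
Proof.
move=> LG; elim: r => [|i r IH].
  by exists 0%R => // s; rewrite big_nil normr0 mul0r.
have [c c0 h] := linear_growthD (LG i) IH; exists c => // s; rewrite big_cons; exact: h.
Qed.

Lemma integral_history_le G c (t : R) : (0 <= c)%R ->
  (forall s, `|G s| <= c * (size s).+1%:R)%R -> (0 <= t)%R ->
  \int[P]_w `|(G (history t w))%:E| <= (c * (1 + expR (C * t)))%:E.
Proof.
move=> c0 Gc t0.
have meta : measurable_fun setT (fun w => (Defs.eta xi t w)%:R%:E : \bar R).
  apply/measurable_EFinP; have := measurable_history t (fun s => (size s)%:R).
  by under eq_fun do rewrite size_history.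
apply: (@le_trans _ _ (\int[P]_w (c%:E * (1 + (Defs.eta xi t w)%:R%:E)))).
  apply: ge0_le_integral => //.
  - by apply: measurableT_comp => //; apply/measurable_EFinP; exact: measurable_history.
  - by apply: emeasurable_funM => //; exact: emeasurable_funD.
  - move=> w _; rewrite -EFinD -EFinM abse_EFin lee_fin; have := Gc (history t w).
    by rewrite size_history -natr1 addrC.
rewrite ge0_integralZl_EFin //; last 2 first.
- by move=> w _; rewrite -EFinD lee_fin addr_ge0.
- exact: emeasurable_funD.
rewrite EFinM lee_wpmul2l ?lee_fin // ge0_integralD // integral_probability_cst.
by rewrite EFinD leeD2l // integral_eta_le.
Qed.

Lemma integrable_history G (t : R) : linear_growth G -> (0 <= t)%R ->
  P.-integrable setT (fun w => (G (history t w))%:E).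
Proof.
move=> [c c0 Gc] t0; apply/integrableP; split.
  by apply/measurable_EFinP; exact: measurable_history.
by rewrite (le_lt_trans (integral_history_le c0 Gc t0)) ?ltry.
Qed.

Let box (T : R) (x : R * Omega) : R := \1_(`[0%R, T]%classic : set R) x.1.

Let measurable_box G T : measurable_fun setT
  (fun x : R * Omega => (G (history x.1 x.2) * box T x)%:E).
Proof.
apply/measurable_EFinP; apply: measurable_funM; first exact: measurable_history2.
have m1 : measurable_fun setT (\1_(`[0%R, T]%classic : set R) : R -> R).
  exact: measurable_indic.
exact: (measurableT_comp m1 measurable_fst).
Qed.

Lemma integrable_history2 G (T : R) : linear_growth G -> (0 <= T)%R ->
  (leb \x P).-integrable setT (fun x => (G (history x.1 x.2) * box T x)%:E).
Proof.
move=> [c c0 Gc] T0; apply/integrable12ltyP; first exact: measurable_box.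
have mc : measurable_fun setT (fun v : R =>
    ((c * (1 + expR (C * T))) * \1_(`[0%R, T]%classic : set R) v)%:E).
  by apply/measurable_EFinP; apply: measurable_funM => //; exact: measurable_indic.
apply: (@le_lt_trans _ _ (\int[leb]_v
    ((c * (1 + expR (C * T))) * \1_(`[0%R, T]%classic : set R) v)%:E)).
  apply: ge0_le_integral => //.
  - by move=> v _; exact: integral_ge0.
  - apply: (measurable_fun_fubini_tonelli_F (m2 := P)
      (fun x => `|(G (history x.1 x.2) * box T x)%:E|)) => //.
    by apply: measurableT_comp => //; exact: measurable_box.
  move=> v _; rewrite /box /= indicE; case: (boolP (v \in _)) => [|_].
    rewrite inE /= in_itv /= => /andP[v0 vT]; rewrite mulr1.
    under eq_integral do rewrite mulr1.
    apply: le_trans (integral_history_le c0 Gc v0) _.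
    by rewrite lee_fin ler_wpM2l // lerD2l ler_expR ler_wpM2l.
  rewrite integral0_eq ?mulr0 // => w _; by rewrite /= mulr0 normr0.
under eq_integral do rewrite EFinM.
rewrite ge0_integralZl_EFin //; last 2 first.
- by apply/measurable_EFinP; exact: measurable_indic.
- by rewrite mulr_ge0 // addr_ge0 ?expR_ge0.
rewrite integral_indic // setIT; apply: lte_mul_pinfty => //.
  by rewrite lee_fin mulr_ge0 // addr_ge0 ?expR_ge0.
have := lebesgue_measure_itv `[0%R, T] => /= ->.
by case: ifP => _; rewrite ?ltry // -EFinB ltry.
Qed.

Definition mean G (t : R) : R := fine (\int[P]_w (G (history t w))%:E).

Lemma EFin_mean G (t : R) : linear_growth G -> (0 <= t)%R ->
  (mean G t)%:E = \int[P]_w (G (history t w))%:E.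
Proof. by move=> LG t0; rewrite /mean fineK // integrable_fin_num // integrable_history. Qed.

Lemma mean_le G c (t : R) : (0 <= c)%R ->
  (forall s, `|G s| <= c * (size s).+1%:R)%R -> (0 <= t)%R ->
  (`|mean G t| <= c * (1 + expR (C * t)))%R.
Proof.
move=> c0 Gc t0; have LG : linear_growth G by exists c.
rewrite -lee_fin -abse_EFin EFin_mean //.
apply: le_trans (integral_history_le c0 Gc t0); apply: le_abse_integral => //.
by apply/measurable_EFinP; exact: measurable_history.
Qed.

Lemma meanD G H (t : R) : linear_growth G -> linear_growth H -> (0 <= t)%R ->
  mean (fun s => G s + H s)%R t = (mean G t + mean H t)%R.
Proof.
move=> LG LH t0; apply: EFin_inj; rewrite EFinD !EFin_mean //; last exact: linear_growthD.
by under eq_integral do rewrite EFinD; rewrite integralD //; exact: integrable_history.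
Qed.

Lemma meanZ (k : R) G (t : R) : linear_growth G -> (0 <= t)%R ->
  mean (fun s => k * G s)%R t = (k * mean G t)%R.
Proof.
move=> LG t0; apply: EFin_inj; rewrite EFinM !EFin_mean //; last exact: linear_growthZ.
by under eq_integral do rewrite EFinM; rewrite integralZl //; exact: integrable_history.
Qed.

Lemma mean_cst (k : R) (t : R) : mean (fun=> k) t = k.
Proof. by rewrite /mean integral_probability_cst. Qed.

Lemma mean_sum I (r : seq I) (G : I -> seq M -> R) (t : R) :
  (forall i, linear_growth (G i)) -> (0 <= t)%R ->
  mean (fun s => \sum_(i <- r) G i s)%R t = (\sum_(i <- r) mean (G i) t)%R.
Proof.
move=> LG t0; elim: r => [|i r IH].
  by under [X in mean X _]eq_fun do rewrite big_nil; rewrite mean_cst big_nil.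
under [X in mean X _]eq_fun do rewrite big_cons.
by rewrite meanD // ?big_cons ?IH //; exact: linear_growth_sum.
Qed.

Lemma eq_mean_ae G H (t : R) : {ae P, forall w, G (history t w) = H (history t w)} ->
  mean G t = mean H t.
Proof.
move=> GH; congr fine; apply: ae_eq_integral => //.
- by apply/measurable_EFinP; exact: measurable_history.
- by apply/measurable_EFinP; exact: measurable_history.
by apply: filterS GH => w -> _.
Qed.

Lemma integral_itv_box G (T : R) w : \int[leb]_(v in `[0%R, T]) (G (history v w))%:E =
  \int[leb]_v (G (history v w) * box T (v, w))%:E.
Proof.
rewrite integral_mkcond; apply: eq_integral => v _; rewrite /patch /box /= indicE.
by case: ifP => _; rewrite ?mulr1 ?mulr0.
Qed.

Lemma integrable_occupation G (T : R) : linear_growth G -> (0 <= T)%R ->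
  P.-integrable setT (fun w => \int[leb]_(v in `[0%R, T]) (G (history v w))%:E).
Proof.
move=> LG T0; under eq_fun do rewrite integral_itv_box.
have ibox := integrable_history2 LG T0.
have mbox := measurable_int _ ibox.
(* The coordinates are swapped because [integrable_fubini_F] integrates out the second one, here
   time. *)
have sw : (P \x leb).-integrable setT
    (fun x : Omega * R => (G (history x.2 x.1) * box T (x.2, x.1))%:E).
  apply/integrable12ltyP.
    have msw : measurable_fun [set: Omega * R] (fun x : Omega * R => (x.2, x.1)).
      exact: measurable_swap.
    exact: (measurableT_comp (measurable_box G T) msw).
  by move/(integrable21ltyP leb P mbox) : ibox.
exact: (integrable_fubini_F sw).
Qed.

Lemma integrable_mean G (T : R) : linear_growth G -> (0 <= T)%R ->
  leb.-integrable `[0%R, T] (EFin \o mean G).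
Proof.
move=> LG T0; have := integrable_fubini_F (integrable_history2 LG T0).
rewrite /fubini_F => iF; apply/integrable_mkcond => //.
apply: eq_integrable iF => // v _; rewrite /patch /= /box /= indicE.
case: ifPn => [|_]; last by apply: integral0_eq => w _; rewrite mulr0.
rewrite inE /= in_itv /= => /andP[v0 _]; rewrite EFin_mean //.
by apply: eq_integral => w _; rewrite mulr1.
Qed.

Lemma mean_occupation G (T : R) : linear_growth G -> (0 <= T)%R ->
  \int[P]_w \int[leb]_(v in `[0%R, T]) (G (history v w))%:E =
  \int[leb]_(v in `[0%R, T]) (mean G v)%:E.
Proof.
move=> LG T0; under eq_integral do rewrite integral_itv_box.
rewrite -(Fubini (integrable_history2 LG T0)) [RHS]integral_mkcond.
apply: eq_integral => v _; rewrite /patch /box /= indicE.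
case: ifPn => [|_]; last by apply: integral0_eq => w _; rewrite mulr0.
rewrite inE /= in_itv /= => /andP[v0 _]; rewrite EFin_mean //.
by apply: eq_integral => w _; rewrite mulr1.
Qed.

(* The marks equal to [b] in [s], each weighted by [G] of the preceding prefix. *)
Definition tally b (G : seq M -> R) (s : seq M) : R :=
  (\sum_(n < size s) (nth b s n == b)%:R * G (take n s))%R.

Lemma tally_marks b G N w : tally b G (marks e N w) =
  (\sum_(n < N) (e n w == b)%:R * G (marks e n w))%R.
Proof.
rewrite /tally size_marks; apply: eq_bigr => n _.
rewrite nth_mkseq //; congr (_ * G _)%R.
by rewrite /marks /mkseq -map_take take_iota; have /minn_idPl -> := ltnW (ltn_ord n).
Qed.

Lemma linear_growth_tally b G : (forall s, `|G s| <= 1)%R -> linear_growth (tally b G).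
Proof.
move=> G1; exists 1%R => // s; rewrite mul1r /tally (le_trans (ler_norm_sum _ _ _)) //.
apply: (@le_trans _ _ (\sum_(n < size s) 1)%R); last first.
  by rewrite sumr_const card_ord ler_nat.
apply: ler_sum => n _; rewrite normrM; case: (_ == _); rewrite ?normr1 ?mul1r //.
by rewrite normr0 mul0r.
Qed.

(** The compensator formula for a counting process: [mark_stay] summed over [n]. Nonnegativity
    allows all exchanges of sums and integrals; the signed case follows from positive and negative
    parts. *)
Lemma mean_tally_ge0 b G (t : R) : (forall s, 0 <= G s)%R -> (forall s, G s <= 1)%R ->
  linear_growth (fun s => J s b * Q s * G s)%R -> (0 <= t)%R ->
  (mean (tally b G) t)%:E =
  \int[leb]_(v in `[0%R, t]) (mean (fun s => J s b * Q s * G s)%R v)%:E.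
Proof.
move=> G0 G1 Lpsi t0; set psi := (fun s => (J s b * Q s * G s)%R).
have psi0 s : (0 <= psi s)%R by rewrite !mulr_ge0.
rewrite -mean_occupation // EFin_mean //; last first.
  by apply: linear_growth_tally => s; rewrite ger0_norm.
pose S n := [set w | e n w = b] `&` [set w | tau xi n.+1 w <= t%:E].
have mS n : measurable (S n) by exact: measurableI.
pose L n w := (G (marks e n w) * \1_(S n) w)%:E.
have L0 n w : 0 <= L n w by rewrite lee_fin mulr_ge0.
have mL n : measurable_fun setT (L n).
  apply/measurable_EFinP; apply: measurable_funM; last exact: measurable_indic.
  exact: (measurable_countable_fun (measurable_marks HJQ n)).
pose K n (x : R * Omega) := (psi (marks e n x.2) * \1_(stay xi n t) x)%:E.
have K0 n x : 0 <= K n x by rewrite lee_fin mulr_ge0.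
have mK n : measurable_fun setT (K n) := measurable_marks_stay HJQ n t psi.
have mKsum : measurable_fun setT (fun x => \sum_(n <oo) K n x) by exact: ge0_emeasurable_sum.
transitivity (\int[P]_w \sum_(n <oo) L n w).
  apply: ge0_ae_eq_integral => //.
  - by apply/measurable_EFinP; exact: measurable_history.
  - exact: ge0_emeasurable_sum.
  - move=> w _; rewrite lee_fin sumr_ge0 // => n _; exact: mulr_ge0.
  - by move=> w _; exact: nneseries_ge0.
  have := ae_regular t0; apply: filterS => w [xi0 _ ex] _.
  have le := tau_le_eta xi0 t0 ex.
  rewrite (nneseries_finite_support (N := Defs.eta xi t w)) //; last first.
    move=> n Nn; rewrite /L indicE memNset ?mulr0 // => -[_]; rewrite /mkset le.
    by rewrite ltnNge Nn.
  rewrite /history tally_marks -sumEFin; apply: eq_bigr => n _; rewrite /L mulrC indicE.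
  congr (_ * _%:R)%:E; congr nat_of_bool; apply/idP/idP.
    by move=> /eqP eb; rewrite mem_set //; split => //; rewrite /mkset le.
  by rewrite inE => -[/= -> _].
rewrite integral_nneseries //.
transitivity (\sum_(n <oo) \int[P]_w \int[leb]_v K n (v, w)).
  by apply: eq_eseriesr => n _; exact: (mark_stay HJQ).
rewrite -integral_nneseries //; last 2 first.
- by move=> n; exact: (measurable_fun_fubini_tonelli_G (m1 := leb) _ (mK n)).
- by move=> n w _; exact: integral_ge0.
transitivity (\int[P]_w \int[leb]_v \sum_(n <oo) K n (v, w)).
  apply: eq_integral => w _; rewrite integral_nneseries // => n.
  exact: (measurableT_comp (mK n) (pair2_measurable w)).
apply: ge0_ae_eq_integral => //.
- apply: (measurable_fun_fubini_tonelli_G (m1 := leb) _ mKsum) => x.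
  exact: nneseries_ge0.
- by apply: measurable_int; exact: integrable_occupation.
- by move=> w _; apply: integral_ge0 => v _; exact: nneseries_ge0.
- by move=> w _; apply: integral_ge0 => v _; rewrite lee_fin.
have := ae_regular t0; apply: filterS => w [xi0 _ [m tm]] _.
rewrite [RHS]integral_mkcond; apply: eq_integral => v _; rewrite /patch.
case: ifPn => [|vt]; last first.
  rewrite eseries0 // => n _ _; rewrite /K indicE memNset ?mulr0 // => -[/= vt' _ _].
  by move/negP : vt; apply; rewrite inE /= in_itv.
rewrite inE /= in_itv /= => /andP[v0 vt].
have ev : exists n, v%:E < tau xi n w.
  by exists m; apply: le_lt_trans tm; rewrite lee_fin.
have le := tau_le_eta xi0 v0 ev; pose N := Defs.eta xi v w.
(* A time [v] lies in exactly one holding interval, the one numbered by the jump count at [v], so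
   the series has a single term. *)
have KN n : K n (v, w) = if n == N then (psi (marks e N w))%:E else 0.
  rewrite /K indicE /=; case: (eqVneq n N) => [->|nN].
    rewrite mem_set ?mulr1 //; split => /=; first by rewrite v0 vt.
      by rewrite le.
    by rewrite ltNge le -ltnNge.
  rewrite memNset ?mulr0 // => -[/= _]; rewrite le ltNge le -leqNgt => a1 a2.
  by move/eqP : nN; apply; apply/eqP; rewrite eqn_leq a1.
rewrite (nneseries_finite_support (N := N.+1)) //; last first.
  by move=> n Nn; rewrite KN gtn_eqF.
rewrite big_ord_recr /= KN eqxx big1 ?add0e // => n _.
by rewrite KN ltn_eqF.
Qed.

Lemma mean_tally b G (t : R) : (forall s, `|G s| <= 1)%R ->
  linear_growth (fun s => J s b * Q s * G s)%R -> (0 <= t)%R ->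
  (mean (tally b G) t)%:E =
  \int[leb]_(v in `[0%R, t]) (mean (fun s => J s b * Q s * G s)%R v)%:E.
Proof.
move=> G1 [c c0 Lc] t0.
pose Gp s := Num.max (G s) 0%R; pose Gm s := Num.max (- G s)%R 0%R.
have Gp0 s : (0 <= Gp s)%R by rewrite le_max lexx orbT.
have Gm0 s : (0 <= Gm s)%R by rewrite le_max lexx orbT.
have Gple s : (Gp s <= `|G s|)%R by rewrite ge_max ler_norm /=.
have Gmle s : (Gm s <= `|G s|)%R by rewrite ge_max -normrN ler_norm /=.
have GE s : G s = (Gp s - Gm s)%R.
  have [g|/ltW g] : (G s <= 0)%R \/ (0 < G s)%R by case: (leP (G s) 0%R); [left|right].
    by rewrite /Gp /Gm max_r // max_l ?oppr_ge0 // sub0r opprK.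
  by rewrite /Gp /Gm max_l // max_r ?oppr_le0 // subr0.
have Lpm (H : seq M -> R) : (forall s, 0 <= H s)%R -> (forall s, H s <= `|G s|)%R ->
    linear_growth (fun s => J s b * Q s * H s)%R.
  move=> H0 HG; exists c => // s; apply: le_trans (Lc s).
  by rewrite !normrM ler_wpM2l // ger0_norm.
have LP := Lpm _ Gp0 Gple; have LM := Lpm _ Gm0 Gmle.
have Gp1 s : (Gp s <= 1)%R by exact: le_trans (Gple s) (G1 s).
have Gm1 s : (Gm s <= 1)%R by exact: le_trans (Gmle s) (G1 s).
have Lt (H : seq M -> R) : (forall s, 0 <= H s)%R -> (forall s, H s <= 1)%R ->
    linear_growth (tally b H).
  by move=> H0 H1; apply: linear_growth_tally => s; rewrite ger0_norm.
have -> : tally b G = (fun s => tally b Gp s + (-1) * tally b Gm s)%R.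
  apply/funext => s; rewrite /tally mulN1r -sumrB; apply: eq_bigr => n _.
  by rewrite -mulrBr -GE.
have psiE : (fun s => J s b * Q s * G s)%R =
    (fun s => J s b * Q s * Gp s + (-1) * (J s b * Q s * Gm s))%R.
  by apply/funext => s; rewrite mulN1r -mulrBr -GE.
rewrite meanD //; [|exact: Lt|by apply: linear_growthZ; exact: Lt].
rewrite meanZ //; last exact: Lt.
rewrite EFinD EFinM !mean_tally_ge0 // -integralZl //; last exact: integrable_mean.
rewrite -integralD //; last 2 first.
- exact: integrable_mean.
- by apply: integrableZl => //; exact: integrable_mean.
apply: eq_integral => v; rewrite inE /= in_itv /= => /andP[v0 _].
by rewrite psiE meanD // ?meanZ ?EFinD //; exact: linear_growthZ.
Qed.

(** [B] lists the finitely many possible marks that can change [F], and [D b] is the increment made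
    by [b]. Along the history [F] telescopes into [F [::]] plus tallies, each of which [mean_tally]
    turns into the integral of its intensity. The increment formula is restricted to [J s b != 0]
    because [fire] at a pair that is no edge would change node values without being listed in
    [B]. *)
Lemma dynkin (F : seq M -> R) (B : seq M) (D : M -> seq M -> R) (t : R) :
  linear_growth F -> (forall b s, `|D b s| <= 1)%R ->
  (forall b, linear_growth (fun s => J s b * Q s * D b s)%R) ->
  (forall s b, J s b != 0%R ->
    F (rcons s b) - F s = \sum_(b' <- B) (b == b')%:R * D b' s)%R ->
  (0 <= t)%R ->
  (mean F t)%:E = (F [::])%:E +
    \int[leb]_(v in `[0%R, t]) (mean (fun s => \sum_(b <- B) J s b * Q s * D b s)%R v)%:E.
Proof.
move=> LF D1 LD FD t0.
have -> : mean F t = mean (fun s => F [::] + \sum_(b <- B) tally b (D b) s)%R t.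
  apply: eq_mean_ae; have := ae_regular t0; apply: filterS => w [_ Jw _].
  rewrite /history; elim: (Defs.eta xi t w) => [|N IH].
    by rewrite big1 ?addr0 // => b _; rewrite /tally big_ord0.
  have -> : F (marks e N.+1 w) = (F (marks e N w) +
      \sum_(b <- B) (e N w == b)%:R * D b (marks e N w))%R.
    by rewrite marksS -FD // addrC subrK.
  rewrite IH -addrA -big_split; congr (_ + _)%R; apply: eq_bigr => b _.
  by rewrite !tally_marks big_ord_recr.
have Ltal b : linear_growth (tally b (D b)) by exact: linear_growth_tally.
rewrite meanD //; last 2 first.
- exists `|F [::]|%R => // s; rewrite ler_peMr // ler1n //.
- exact: linear_growth_sum.
rewrite mean_cst EFinD mean_sum //; congr (_ + _).
transitivity (\int[leb]_(v in `[0%R, t])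
    \sum_(b <- B) (mean (fun s => J s b * Q s * D b s)%R v)%:E); last first.
  apply: eq_integral => v; rewrite inE /= in_itv /= => /andP[v0 _].
  by rewrite mean_sum // sumEFin.
rewrite integral_sum //; last by move=> b; exact: integrable_mean.
by rewrite -sumEFin; apply: eq_bigr => b _; exact: mean_tally.
Qed.

End dynkin.

(** * The interacting particle system *)

Lemma normr_sg_le1 {R : realDomainType} (x : R) : `|Num.sg x| <= 1.
Proof. by rewrite normr_sg; case: (_ != _). Qed.

Lemma ler_sum_perturb {R : realDomainType} {T : eqType} (s E : seq T) (a b : T -> R) (c : R) :
  0 <= c -> uniq s -> (forall x, a x <= b x + c * (x \in E)%:R) ->
  \sum_(x <- s) a x <= \sum_(x <- s) b x + c * (size E)%:R.
Proof.
move=> c0 us ab; apply: (@le_trans _ _ (\sum_(x <- s) (b x + c * (x \in E)%:R))).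
  exact: ler_sum.
rewrite big_split /= lerD2l -mulr_sumr ler_wpM2l // -natr_sum ler_nat.
rewrite -big_mkcond /= sum1_count -size_filter; apply: uniq_leq_size.
  exact: filter_uniq.
by move=> x; rewrite mem_filter => /andP[].
Qed.

Lemma sumr_eq_mask {R : pzRingType} {T : eqType} (s : seq T) (x : T) (F : T -> R) :
  uniq s -> \sum_(y <- s) (x == y)%:R * F y = (x \in s)%:R * F x.
Proof.
move=> us; have [xs|xs] := boolP (x \in s).
  rewrite (bigD1_seq x) //= eqxx big1 ?addr0 // => y; rewrite eq_sym => /negbTE ->.
  by rewrite mul0r.
rewrite mul0r big_seq big1 // => y ys; case: eqVneq => [xy|_]; last by rewrite mul0r.
by rewrite xy ys in xs.
Qed.

Section graph.
Context {R : realType} {V : countType}.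
Variables (adj : rel V) (k : V -> V -> R) (m : V -> R) (V1 : pred V).
Variables (nbrs : V -> seq V) (d0 : nat) (K : R).
Hypothesis adjC : forall x y, adj x y = adj y x.
Hypothesis adjxx : forall x, ~~ adj x x.
Hypothesis kC : forall x y, k x y = k y x.
Hypothesis k0 : forall x y, 0 <= k x y.
Hypothesis kadj : forall x y, ~~ adj x y -> k x y = 0.
Hypothesis m0 : forall x, 0 < m x.
Hypothesis nbrsE : forall x y, (y \in nbrs x) = adj x y.
Hypothesis nbrs_uniq : forall x, uniq (nbrs x).
Hypothesis nbrs_size : forall x, (size (nbrs x) <= d0)%N.
Hypothesis K0 : 0 <= K.
Hypothesis mK : forall x, (m x)^-1 <= K.
Hypothesis kK : forall x y, k x y <= K.

(** Explicit finite supports, extended by each transition. Nothing is asked of pairs that are not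
    edges: there [phi y - phi x] may be nonzero, and [k] annihilates it. *)
Definition covered (h : state R V) (s1 : seq V) (s2 : seq (V * V)) : Prop :=
  (forall x, h.1 x != 0 -> x \in s1) /\
  (forall x y, adj x y -> h.2 x y != 0 -> (x, y) \in s2).

Definition admissible (h : state R V) : Prop :=
  (exists s1 s2, covered h s1 s2) /\ forall x y, h.2 x y = - h.2 y x.

(** Both orientations appear because a state stores the coefficient of an edge twice, with opposite
    signs. *)
Definition star x : seq (V * V) := [seq (x, y) | y <- nbrs x] ++ [seq (y, x) | y <- nbrs x].

Definition touched (a : event V) : seq V :=
  if a is Some (inr (x, y)) then [:: x; y] else [::].

Definition touched_edges (a : event V) : seq (V * V) :=
  if a is Some (inl x) then star x else [::].

Lemma fire1_le (h : state R V) a z :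
  `|(fire adj V1 h a).1 z| <= `|h.1 z| + (z \in touched a)%:R.
Proof.
case: a => [[x|[x y]]|] /=; rewrite ?addr0 //.
case: ifP => [/andP[/eqP -> _]|_].
  by rewrite !inE eqxx (le_trans (ler_normD _ _)) // lerD2l normr_sg_le1.
case: ifP => [/andP[/eqP -> _]|_]; last by rewrite lerDl.
by rewrite !inE eqxx orbT (le_trans (ler_normB _ _)) // lerD2l normr_sg_le1.
Qed.

Lemma fire2_le (h : state R V) a p :
  `|(fire adj V1 h a).2 p.1 p.2| <= `|h.2 p.1 p.2| + (p \in touched_edges a)%:R.
Proof.
case: a => [[x|[x y]]|] /=; rewrite ?addr0 //; case: p => p q /=.
case: ifP => [/andP[/eqP -> xq]|_].
  rewrite (le_trans (ler_normB _ _)) // lerD2l mem_cat.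
  by rewrite (_ : (x, q) \in _) ?normr_sg_le1 //; apply/mapP; exists q; rewrite // nbrsE.
case: ifP => [/andP[/eqP -> xp]|_]; last by rewrite lerDl.
rewrite (le_trans (ler_normD _ _)) // lerD2l mem_cat orbC.
by rewrite (_ : (p, x) \in _) ?normr_sg_le1 //; apply/mapP; exists p; rewrite // nbrsE.
Qed.

Lemma fire_covered (h : state R V) a s1 s2 : covered h s1 s2 ->
  covered (fire adj V1 h a) (s1 ++ touched a) (s2 ++ touched_edges a).
Proof.
move=> [c1 c2]; split => [x hx|x y xy hxy]; rewrite mem_cat.
  have := fire1_le h a x; case: (x \in touched a); rewrite ?orbT // addr0 orbF => le.
  apply: c1; apply: contraNneq hx => hx0; rewrite -normr_le0 (le_trans le) //.
  by rewrite hx0 normr0.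
have := fire2_le h a (x, y); case: (_ \in touched_edges a); rewrite ?orbT // addr0 orbF => le.
apply: c2 => //; apply: contraNneq hxy => hx0; rewrite -normr_le0 (le_trans le) //=.
by rewrite hx0 normr0.
Qed.

Lemma fire_admissible (h : state R V) a : admissible h -> admissible (fire adj V1 h a).
Proof.
move=> [[s1 [s2 cov]] anti]; split.
  by exists (s1 ++ touched a), (s2 ++ touched_edges a); exact: fire_covered.
case: a => [[x|[x y]]|] //= p q.
have [->|px] := eqVneq p x; have [->|qx] := eqVneq q x; rewrite /= ?(negbTE (adjxx _)) //.
- by rewrite anti; case: ifP => _; rewrite ?opprD ?opprK.
- by rewrite anti; case: ifP => _; rewrite ?opprB 1?addrC.
Qed.

(** The sums over all of [V] have their intended value only when finitely many terms are nonzero;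
    the covering lists provide this. *)
Lemma total_rateE (h : state R V) s1 s2 : covered h s1 s2 ->
  total_rate m k h = \sum_(x <- undup s1) rate m k h (Some (inl x)) +
                     \sum_(p <- undup s2) rate m k h (Some (inr p)).
Proof.
move=> [c1 c2]; rewrite /total_rate; congr (_ + _).
  rewrite (fsbig_seq _ _ (undup_uniq s1)); apply/esym/fsbig_widen => // x [_ /= /negP].
  rewrite mem_undup => xs; rewrite (_ : h.1 x = 0) ?normr0 ?mul0r //.
  by apply/eqP; apply: contraNT xs; exact: c1.
rewrite (fsbig_seq _ _ (undup_uniq s2)); apply/esym/fsbig_widen => // -[x y] [_ /= /negP].
rewrite mem_undup => xs; case: ifP => // _.
have [xy|xy] := boolP (adj x y); last by rewrite kadj // mul0r.
rewrite (_ : h.2 x y = 0) ?normr0 ?mulr0 //.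
by apply/eqP; apply: contraNT xs; exact: c2.
Qed.

Lemma rate_ge0 (h : state R V) a : 0 <= rate m k h a.
Proof.
case: a => [[x|[x y]]|] //=; first by rewrite mulr_ge0 // invr_ge0 ltW.
by case: ifP => // _; rewrite mulr_ge0.
Qed.

Lemma total_rate_ge0 (h : state R V) : admissible h -> 0 <= total_rate m k h.
Proof.
move=> [[s1 [s2 cov]] _]; rewrite (total_rateE cov) addr_ge0 // sumr_ge0 // => ? _;
  exact: rate_ge0.
Qed.

(** An edge transition changes at most 2 node values, a node transition at most [2 * d0] stored
    coefficients, each by at most 1; a unit of either kind contributes at most [K] to the rate. *)
Lemma total_rate_fire (h : state R V) a : admissible h ->
  total_rate m k (fire adj V1 h a) <= total_rate m k h + K * (2 + 2 * d0%:R).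
Proof.
move=> [[s1 [s2 cov]] _]; have covf := fire_covered a cov.
have cov' : covered h (s1 ++ touched a) (s2 ++ touched_edges a).
  by case: cov => c1 c2; split => *; rewrite mem_cat ?c1 ?c2.
rewrite (total_rateE covf) (total_rateE cov') mulrDr addrACA; apply: lerD.
  apply: (@le_trans _ _ (\sum_(x <- undup (s1 ++ touched a)) rate m k h (Some (inl x)) +
      K * (size (touched a))%:R)).
    apply: ler_sum_perturb => //; first exact: undup_uniq.
    move=> x /=; rewrite mulrC [X in _ <= X + _]mulrC -lerBlDl -mulrBr.
    apply: (@le_trans _ _ ((m x)^-1 * (x \in touched a)%:R)).
      apply: ler_wpM2l; first by rewrite invr_ge0 ltW.
      by rewrite lerBlDl fire1_le.
    exact: ler_wpM2r.
  rewrite lerD2l ler_wpM2l // ler_nat.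
  by case: a {covf cov'} => [[x|[x y]]|].
apply: (@le_trans _ _ (\sum_(x <- undup (s2 ++ touched_edges a)) rate m k h (Some (inr x)) +
    K * (size (touched_edges a))%:R)).
  apply: ler_sum_perturb => //; first exact: undup_uniq.
  move=> [x y] /=; case: ifP => _; last by rewrite add0r mulr_ge0.
  rewrite -lerBlDl -mulrBr.
  apply: (@le_trans _ _ (k x y * ((x, y) \in touched_edges a)%:R)); last exact: ler_wpM2r.
  by rewrite ler_wpM2l // lerBlDl (fire2_le h a (x, y)).
rewrite lerD2l ler_wpM2l // -natrM ler_nat mul2n -addnn.
case: a {covf cov'} => [[x|[x y]]|] //=.
by rewrite size_cat !size_map leq_add.
Qed.

Lemma rate_total_eq0 (h : state R V) a : admissible h -> total_rate m k h = 0 -> rate m k h a = 0.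
Proof.
move=> [[s1 [s2 cov]] _]; rewrite (total_rateE cov) => /eqP.
rewrite paddr_eq0; last 2 first.
- by apply: sumr_ge0 => *; exact: rate_ge0.
- by apply: sumr_ge0 => *; exact: rate_ge0.
rewrite psumr_eq0; last by move=> *; exact: rate_ge0.
rewrite psumr_eq0; last by move=> *; exact: rate_ge0.
move=> /andP[/allP r1 /allP r2].
case: cov => c1 c2; case: a => [[x|[x y]]|] //.
  have [xs|xs] := boolP (x \in undup s1); first by have /eqP := r1 x xs.
  rewrite /= (_ : h.1 x = 0) ?normr0 ?mul0r //.
  by apply/eqP; apply: contraNT xs; rewrite mem_undup; exact: c1.
have [xs|xs] := boolP ((x, y) \in undup s2); first by have /eqP := r2 _ xs.
rewrite /=; case: ifP => // _.
have [xy|xy] := boolP (adj x y); last by rewrite kadj // mul0r.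
rewrite (_ : h.2 x y = 0) ?normr0 ?mulr0 //.
by apply/eqP; apply: contraNT xs; rewrite mem_undup; exact: c2.
Qed.

(** This holds in the absorbed state too: there all rates vanish, and the certain mark [None] is
    multiplied by total rate 0. *)
Lemma jprob_total (h : state R V) a : admissible h ->
  jprob m k h a * total_rate m k h = rate m k h a.
Proof.
move=> adm; have [t0|t0] := eqVneq (total_rate m k h) 0.
  by rewrite t0 mulr0 rate_total_eq0.
by case: a => [a|] /=; [rewrite divfK|rewrite (negbTE t0) mul0r].
Qed.

Lemma jprob_ge0 (h : state R V) a : admissible h -> 0 <= jprob m k h a.
Proof.
move=> adm; case: a => [a|]; last by rewrite /=; case: ifP.
by apply: divr_ge0; [exact: (rate_ge0 h (Some a))|exact: total_rate_ge0].
Qed.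

Lemma jprob_sum (h : state R V) : admissible h ->
  exists L : seq (event V), uniq L /\ \sum_(b <- L) jprob m k h b = 1.
Proof.
move=> adm; have [t0|t0] := eqVneq (total_rate m k h) 0.
  by exists [:: None]; rewrite big_seq1 /= t0 eqxx.
have [[s1 [s2 cov]] _] := adm.
pose i1 (x : V) : event V := Some (inl x); pose i2 (p : V * V) : event V := Some (inr p).
exists ([seq i1 x | x <- undup s1] ++ [seq i2 p | p <- undup s2]); split.
  rewrite cat_uniq !map_inj_uniq ?undup_uniq ?andbT //=; last 2 first.
  - by move=> ? ? [].
  - by move=> ? ? [].
  by apply/hasPn => b /mapP[p _ ->]; apply/negP => /mapP[].
rewrite big_cat !big_map /= -!mulr_suml -mulrDl -(total_rateE cov) divff //.
Qed.

Lemma rate_neq0_edge (h : state R V) x y : rate m k h (Some (inr (x, y))) != 0 -> adj x y.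
Proof.
rewrite /=; case: ifP => [_|]; last by rewrite eqxx.
by apply: contraNT => /kadj ->; rewrite mul0r.
Qed.

Lemma chain_ext (h : state R V) (a b : nat -> event V) n :
  (forall i, (i < n)%N -> a i = b i) -> chain adj V1 h a n = chain adj V1 h b n.
Proof.
elim: n => //= n IH ab; rewrite IH ?ab // => i lin; apply: ab; exact: ltnW.
Qed.

Variable f : state R V.
Hypothesis fadm : admissible f.

(** The state as a deterministic function of the history; the default [None] lies beyond the
    [size s] marks that are read. *)
Definition state_of (s : seq (event V)) : state R V := chain adj V1 f (nth None s) (size s).

Lemma state_of_rcons s b : state_of (rcons s b) = fire adj V1 (state_of s) b.
Proof.
rewrite /state_of size_rcons /= nth_rcons ltnn eqxx; congr (fire _ _ _ _).
by apply: chain_ext => i lis; rewrite nth_rcons lis.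
Qed.

Lemma state_of_admissible s : admissible (state_of s).
Proof. by elim/last_ind: s => // s b IH; rewrite state_of_rcons; exact: fire_admissible. Qed.

(** The initial rate plus one increment of [total_rate_fire] per jump; this constant is the [C] of
    the non-explosion bound. *)
Lemma total_rate_state_of s : total_rate m k (state_of s) <=
  (total_rate m k f + K * (2 + 2 * d0%:R)) * (size s).+1%:R.
Proof.
set c := K * _; have c0 : 0 <= c by rewrite mulr_ge0 // addr_ge0.
apply: (@le_trans _ _ (total_rate m k f + c * (size s)%:R)).
  elim/last_ind: s => [|s b IH]; first by rewrite mulr0 addr0.
  rewrite state_of_rcons size_rcons -natr1 mulrDr mulr1 addrA.
  apply: le_trans (total_rate_fire b (state_of_admissible s)) _.
  by rewrite lerD2r.
rewrite mulrDl lerD //; last by rewrite ler_wpM2l // ler_nat.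
by rewrite ler_peMr ?total_rate_ge0 // ler1n.
Qed.

Lemma linear_growth_step (G : state R V -> R) :
  (forall h a, `|G (fire adj V1 h a)| <= `|G h| + 1) ->
  linear_growth (fun s => G (state_of s)).
Proof.
move=> G1; exists (`|G f| + 1) => [|s]; first by rewrite addr_ge0.
apply: (@le_trans _ _ (`|G f| + (size s)%:R)).
  elim/last_ind: s => [|s b IH]; first by rewrite addr0.
  rewrite state_of_rcons size_rcons -natr1 addrA (le_trans (G1 _ _)) // lerD2r //.
rewrite mulrDl mul1r lerD //; first by rewrite ler_peMr // ler1n.
by rewrite ler_nat.
Qed.

Lemma linear_growth_node x : linear_growth (fun s => (state_of s).1 x).
Proof.
apply: (linear_growth_step (G := fun h => h.1 x)) => h a.
by rewrite (le_trans (fire1_le h a x)) // lerD2l; case: (_ \in _).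
Qed.

Lemma linear_growth_edge x y : linear_growth (fun s => (state_of s).2 x y).
Proof.
apply: (linear_growth_step (G := fun h => h.2 x y)) => h a.
by rewrite (le_trans (fire2_le h a (x, y))) // lerD2l; case: (_ \in _).
Qed.

Lemma linear_growth_rate (D : event V -> seq (event V) -> R) b :
  (forall b s, `|D b s| <= 1) ->
  linear_growth (fun s => jprob m k (state_of s) b * total_rate m k (state_of s) * D b s).
Proof.
move=> D1; suff [c c0 h] : linear_growth (fun s => rate m k (state_of s) b).
  exists c => // s; rewrite (jprob_total _ (state_of_admissible s)) normrM.
  by apply: le_trans (h s); rewrite ler_piMr.
case: b => [[x|[x y]]|] /=; last by exists 0 => // s; rewrite normr0 mul0r.
  have [c c0 h] := linear_growth_node x; exists (c * (m x)^-1) => [|s].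
    by rewrite mulr_ge0 // invr_ge0 ltW.
  rewrite normrM normr_id [X in _ * X <= _]gtr0_norm ?invr_gt0 // mulrAC.
  by rewrite ler_wpM2r // invr_ge0 ltW.
case: (pickle x < pickle y)%N; last by exists 0 => // s; rewrite normr0 mul0r.
have [c c0 h] := linear_growth_edge x y; exists (k x y * c) => [|s]; first exact: mulr_ge0.
by rewrite normrM normr_id ger0_norm // -mulrA ler_wpM2l.
Qed.

(** * Averaged equations of the particle system *)

Section process.
Context {d} {Omega : measurableType d} (P : probability Omega R).
Variables (e : nat -> Omega -> event V) (xi : nat -> Omega -> \bar R).
Hypothesis ips : is_IPS P adj V1 m k f e xi.

Let J s b := jprob m k (state_of s) b.
Let Q s := total_rate m k (state_of s).

(** The product law for [(size s).+1] transitions is the one for [size s] transitions times a last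
    factor; that factor is the conditional law of the next mark and clock. *)
Lemma marked_clocks_IPS : marked_clocks P e xi J Q.
Proof.
have [me [mxi law]] := ips; split => //.
- by move=> s b; exact/jprob_ge0/state_of_admissible.
- by move=> s; exact/total_rate_ge0/state_of_admissible.
- by move=> s; exact/jprob_sum/state_of_admissible.
move=> s b ts u ts0 u0.
have marksP w : marks e (size s) w = s <-> forall i, (i < size s)%N -> e i w = nth None s i.
  split => [<- i|h]; first by rewrite size_marks => lis; rewrite nth_mkseq.
  apply: (@eq_from_nth _ None); first by rewrite size_marks.
  by move=> i; rewrite size_marks => lis; rewrite nth_mkseq // h.
(* The thresholds of the past, followed by [u] for the next clock. *)
pose ts' i := if (i < size s)%N then ts i else u.
have ts'0 i : 0 <= ts' i by rewrite /ts'; case: ifP.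
have := law (size s).+1 (nth None (rcons s b)) ts' ts'0.
have := law (size s) (nth None s) ts ts0.
rewrite (_ : mkset _ = [set w | marks e (size s) w = s] `&` above xi (size s) ts); last first.
  apply/seteqP; split => w /=.
    by move=> h; split; [apply/marksP => i /h[]|move=> i /h[]].
  by move=> [/marksP h1 h2] i lis; split; [exact: h1|exact: h2].
move=> ->.
rewrite (_ : mkset _ = [set w | marks e (size s) w = s] `&` above xi (size s) ts `&`
   ([set w | e (size s) w = b] `&` [set w | (u%:E < xi (size s) w)%E])); last first.
  apply/seteqP; split => w /=.
    move=> h; split; last first.
      by have := h _ (leqnn _); rewrite nth_rcons /ts' ltnn eqxx.
    split; first (apply/marksP => i lis; have [-> _] := h i (ltnW lis)).
      by rewrite nth_rcons lis.
    by move=> i lis; have [_] := h i (ltnW lis); rewrite /ts' lis.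
  move=> [[/marksP h1 h2] [h3 h4]] i; rewrite ltnS leq_eqVlt => /predU1P[->|lis].
    by rewrite nth_rcons /ts' ltnn eqxx.
  by rewrite nth_rcons /ts' lis; split; [exact: h1|exact: h2].
move=> ->; rewrite -EFinM big_ord_recr /= nth_rcons /ts' ltnn eqxx; congr (_%:E).
have st_s : chain adj V1 f (nth None (rcons s b)) (size s) = state_of s.
  by apply: chain_ext => i lis; rewrite nth_rcons lis.
rewrite [RHS]mulrC st_s; congr (_ * _).
apply: eq_bigr => i _; rewrite ltn_ord nth_rcons ltn_ord.
rewrite (@chain_ext f (nth None (rcons s b)) (nth None s)) // => j lji.
by rewrite nth_rcons (ltn_trans lji (ltn_ord i)).
Qed.

Lemma state_of_history t w : state_of (history e xi t w) = ips_at adj V1 f e xi t w.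
Proof.
rewrite /state_of /history /ips_at size_marks; apply: chain_ext => i lin.
by rewrite nth_mkseq.
Qed.

Let C := total_rate m k f + K * (2 + 2 * d0%:R).

Lemma growth_rate_ge0 : 0 <= C.
Proof. by rewrite addr_ge0 ?total_rate_ge0 // mulr_ge0 // addr_ge0. Qed.

Notation leb := (@lebesgue_measure R).

(** Only edges at [x] change the value at [x]. The increment is the sign of the edge coefficient and
    the rate is [k] times its absolute value, so the intensity is linear in the state. *)
Lemma node_dynkin x (t : R) : x \notin V1 -> 0 <= t ->
  ((mean P e xi (fun s => (state_of s).1 x) t)%:E = (f.1 x)%:E +
    \int[leb]_(v in `[0%R, t])
      (mean P e xi (fun s => \sum_(z <- nbrs x) k x z * (state_of s).2 x z) v)%:E)%E.
Proof.
move=> xV1 t0.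
(* An edge is listed once, in [pickle] order, so [x] may be its first or its second end; both forms
   are included, and the one in the wrong order has rate 0. *)
pose out z : event V := Some (inr (x, z)); pose inn z : event V := Some (inr (z, x)).
pose B := [seq out z | z <- nbrs x] ++ [seq inn z | z <- nbrs x].
pose D (b : event V) s : R := if b is Some (inr (p, q)) then
  (if p == x then Num.sg ((state_of s).2 p q) else - Num.sg ((state_of s).2 p q)) else 0.
have D1 b s : `|D b s| <= 1.
  rewrite /D; case: b => [[y|[p q]]|]; rewrite ?normr0 //.
  by case: ifP => _; rewrite ?normrN normr_sg_le1.
apply: (eq_trans (dynkin marked_clocks_IPS growth_rate_ge0 total_rate_state_of
  (F := fun s => (state_of s).1 x) (B := B) (D := D) _ D1 _ _ t0)).
- exact: linear_growth_node.
- by move=> b; exact: linear_growth_rate.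
- move=> s b Jb; rewrite state_of_rcons /B big_cat !big_map /=.
  case: b Jb => [[y|[p q]]|] Jb.
  + by rewrite /= subrr !big1 ?addr0 // => z _; rewrite mul0r.
  + have r0 : rate m k (state_of s) (Some (inr (p, q))) != 0.
      by apply: contraNneq Jb => r0; rewrite /J /jprob r0 mul0r.
    have pq := rate_neq0_edge r0.
    have qp : q == p = false by apply: contraTF pq => /eqP ->; exact: adjxx.
    rewrite (eq_bigr (fun z => (q == z)%:R * ((p == x)%:R * D (out z) s))); last first.
      move=> z _; rewrite (_ : (_ == out z) = (q == z) && (p == x)).
        by rewrite -mulnb natrM mulrA.
      by apply/idP/idP => [/eqP[-> ->]|/andP[/eqP -> /eqP ->]]; rewrite ?eqxx.
    rewrite [X in _ = _ + X](eq_bigr (fun z =>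
        (p == z)%:R * ((q == x)%:R * D (inn z) s))); last first.
      move=> z _; rewrite (_ : (_ == inn z) = (p == z) && (q == x)).
        by rewrite -mulnb natrM mulrA.
      by apply/idP/idP => [/eqP[-> ->]|/andP[/eqP -> /eqP ->]]; rewrite ?eqxx.
    rewrite !sumr_eq_mask // !nbrsE /D /= eqxx.
    have [xp|xp] := eqVneq p x.
      rewrite xp in pq qp *; rewrite pq xV1 /= qp !mul1r mul0r mulr0 addr0.
      by rewrite addrAC subrr add0r.
    rewrite mul0r mulr0 add0r /=.
    have [xq|xq] := eqVneq q x; last by rewrite mul0r mulr0 subrr.
    rewrite xq in pq *; rewrite adjC pq xV1 /= !mul1r.
    by rewrite addrAC subrr add0r.
  + by rewrite /= subrr !big1 ?addr0 // => z _; rewrite mul0r.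
congr (_ + _)%E; apply: eq_integral => v _; congr (mean _ _ _ _ _)%:E.
apply/funext => s; have adm := state_of_admissible s; have [_ anti] := adm.
rewrite (eq_bigr (fun b => rate m k (state_of s) b * D b s)); last first.
  by move=> b _; rewrite /J /Q (jprob_total _ adm).
rewrite /B big_cat !big_map /= -big_split /= big_seq [RHS]big_seq.
apply: eq_bigr => z; rewrite nbrsE => xz.
have zx : z == x = false by apply: contraTF xz => /eqP ->; exact: adjxx.
rewrite /D eqxx zx.
rewrite [k z x]kC [(state_of s).2 z x]anti sgrN opprK normrN.
(* Exactly one of the two forms has a rate; after the antisymmetry rewriting both give [k x z] times
   the coefficient along [x z]. *)
case: (ltngtP (pickle x) (pickle z)) => [_|_|/(pcan_inj pickleK) xz']; last first.
  by rewrite xz' eqxx in zx.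
- by rewrite mul0r add0r -mulrA mulrC [_ * Num.sg _]mulrC mulr_sg_norm mulrC.
- by rewrite mul0r addr0 -mulrA [_ * Num.sg _]mulrC mulr_sg_norm.
Qed.

Lemma edge_dynkin x y (t : R) : adj x y -> 0 <= t ->
  ((mean P e xi (fun s => (state_of s).2 x y) t)%:E = (f.2 x y)%:E +
    \int[leb]_(v in `[0%R, t])
      (mean P e xi (fun s => (m y)^-1 * (state_of s).1 y +
                            (- (m x)^-1) * (state_of s).1 x) v)%:E)%E.
Proof.
move=> xy t0; have yx : y == x = false by apply: contraTF xy => /eqP ->; exact: adjxx.
pose at_ z : event V := Some (inl z); pose B := [:: at_ x; at_ y].
(* Seen from [x], firing at [x] subtracts the sign of its node value from the coefficient of the
   edge, and firing at [y] adds the sign of the value at [y]. *)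
pose D (b : event V) s : R := if b is Some (inl z) then
  (if z == x then - Num.sg ((state_of s).1 z) else Num.sg ((state_of s).1 z)) else 0.
have D1 b s : `|D b s| <= 1.
  rewrite /D; case: b => [[z|[p q]]|]; rewrite ?normr0 //.
  by case: ifP => _; rewrite ?normrN normr_sg_le1.
apply: (eq_trans (dynkin marked_clocks_IPS growth_rate_ge0 total_rate_state_of
  (F := fun s => (state_of s).2 x y) (B := B) (D := D) _ D1 _ _ t0)).
- exact: linear_growth_edge.
- by move=> b; exact: linear_growth_rate.
- move=> s b _.
  have Dx : D (at_ x) s = - Num.sg ((state_of s).1 x) by rewrite /D /= eqxx.
  have Dy : D (at_ y) s = Num.sg ((state_of s).1 y) by rewrite /D /= yx.
  rewrite state_of_rcons /B !big_cons big_nil addr0 Dx Dy.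
  case: b => [[z|[p q]]|]; last 2 first.
  + by rewrite /= subrr !mul0r addr0.
  + by rewrite /= subrr !mul0r addr0.
  have inl_eq (a b : V) : (at_ a == at_ b) = (a == b).
    by apply/idP/idP => [/eqP[->]|/eqP ->].
  have xy' : x == y = false by rewrite eq_sym.
  rewrite !inl_eq /= (eq_sym x z) (eq_sym y z).
  have [->|zx] := eqVneq z x; first rewrite ?eqxx xy xy' /= mul0r addr0 mul1r.
    by rewrite addrAC subrr add0r.
  have [->|zy] := eqVneq z y; last by rewrite /= subrr !mul0r addr0.
  by rewrite ?eqxx adjC xy /= mul0r add0r mul1r addrAC subrr add0r.
congr (_ + _)%E; apply: eq_integral => v _; congr (mean _ _ _ _ _)%:E.
apply/funext => s; have adm := state_of_admissible s.
rewrite (eq_bigr (fun b => rate m k (state_of s) b * D b s)); last first.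
  by move=> b _; rewrite /J /Q (jprob_total _ adm).
rewrite /B !big_cons big_nil addr0 /D /at_ /= eqxx yx addrC.
have sgE (a c : R) : `|a| / c * Num.sg a = c^-1 * a.
  by rewrite mulrAC [`|a| * _]mulrC mulr_sg_norm mulrC.
by rewrite mulrN !sgE mulNr.
Qed.

Lemma state_of_boundary x s : x \in V1 -> (state_of s).1 x = f.1 x.
Proof.
move=> xV1; elim/last_ind: s => // s b IH; rewrite state_of_rcons.
case: b => [[z|[p q]]|] //=.
have [<-|xp] := eqVneq x p; first rewrite xV1 /=.
  by have [<-|xq] := eqVneq x q; rewrite ?xV1.
by have [<-|xq] := eqVneq x q; rewrite /= ?xV1.
Qed.

(** * From the averaged equations to the wave equation *)

Variables (phi psi : V -> R).
Hypothesis f1E : forall x, f.1 x = m x * psi x.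
Hypothesis f2E : forall x y, f.2 x y = phi y - phi x.
Hypothesis psiV1 : forall x, x \in V1 -> psi x = 0.

Notation avg := (mean P e xi).
(** Its average is the velocity of [u] at [x]; the average of [E x y] along an edge is the
    displacement difference, by [edge_diff]. *)
Let N x s := (m x)^-1 * (state_of s).1 x.
Let E x y s := (state_of s).2 x y.
Let u := u_sol P adj V1 m phi f e xi.

Let LN x : linear_growth (N x).
Proof. by apply: linear_growthZ; exact: linear_growth_node. Qed.

Let LkE x z : linear_growth (fun s => k x z * E x z s).
Proof. by apply: linear_growthZ; exact: linear_growth_edge. Qed.

Let LS x : linear_growth (fun s => \sum_(z <- nbrs x) k x z * E x z s).
Proof. exact: linear_growth_sum. Qed.

Let integrable_avg G t : linear_growth G -> 0 <= t ->
  leb.-integrable `[0, t] (EFin \o avg G).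
Proof. exact: (integrable_mean marked_clocks_IPS growth_rate_ge0 total_rate_state_of). Qed.

Let avgD G G' t := @meanD _ _ _ P _ e xi J Q C marked_clocks_IPS growth_rate_ge0
  total_rate_state_of G G' t.
Let avgZ a G t := @meanZ _ _ _ P _ e xi J Q C marked_clocks_IPS growth_rate_ge0
  total_rate_state_of a G t.

Let avg_bounded G T : linear_growth G -> 0 <= T ->
  exists B, forall v, 0 <= v <= T -> `|avg G v| <= B.
Proof.
move=> [c c0 Gc] T0; exists (c * (1 + expR (C * T))) => v /andP[v0 vT].
have C0 := growth_rate_ge0.
apply: le_trans (mean_le marked_clocks_IPS C0 total_rate_state_of c0 Gc v0) _.
by rewrite ler_wpM2l // lerD2l ler_expR ler_wpM2l.
Qed.

Let real_dynkin (a b t : R) G : linear_growth G -> 0 <= t ->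
  (a%:E = b%:E + \int[leb]_(v in `[0%R, t]) (avg G v)%:E)%E ->
  a = b + \int[leb]_(v in `[0, t]) avg G v.
Proof.
move=> LG t0 h; have := congr1 fine h; rewrite /= fineD //.
by apply: integrable_fin_num => //; exact: integrable_avg.
Qed.

(** Fubini moves the expectation inside the time integral of the occupation. *)
Let u_primitive x t : 0 <= t -> u x t = phi x + \int[leb]_(v in `[0, t]) avg (N x) v.
Proof.
move=> t0; have Lx := linear_growth_node x.
rewrite /u /u_sol; congr (_ + _).
rewrite (_ : (\int[P]_w _)%E = (\int[leb]_(v in `[0%R, t])
    (avg (fun s => (state_of s).1 x) v)%:E)%E); last first.
  rewrite -(mean_occupation marked_clocks_IPS growth_rate_ge0 total_rate_state_of Lx t0).
  apply: eq_integral => w _; apply: eq_integral => v _; by rewrite state_of_history.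
rewrite -/(Rintegral leb `[0, t]%classic (avg (fun s => (state_of s).1 x))).
rewrite mulrC -(RintegralZl _ _ (integrable_avg Lx t0)) //.
apply: eq_Rintegral => v; rewrite inE /= in_itv /= => /andP[v0 _].
by rewrite avgZ.
Qed.

Let node_primitive x t : x \notin V1 -> 0 <= t -> avg (N x) t = psi x +
  \int[leb]_(v in `[0, t]) avg (fun s => (m x)^-1 * \sum_(z <- nbrs x) k x z * E x z s) v.
Proof.
move=> xV1 t0; have Lx := linear_growth_node x.
rewrite avgZ // (real_dynkin (LS x) t0 (node_dynkin xV1 t0)) f1E mulrDr mulKf ?gt_eqF //.
congr (_ + _); rewrite -(RintegralZl _ _ (integrable_avg (LS x) t0)) //.
apply: eq_Rintegral => v; rewrite inE /= in_itv /= => /andP[v0 _].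
by rewrite avgZ.
Qed.

(** Both sides equal [phi z - phi x] at time 0 and are primitives of [avg (N z) - avg (N x)]. This
    closes the system: edge averages are expressed through [u]. *)
Let edge_diff x z t : adj x z -> 0 <= t -> avg (E x z) t = u z t - u x t.
Proof.
move=> xz t0; have Nx := linear_growth_node x; have Nz := linear_growth_node z.
have LD : linear_growth (fun s => (m z)^-1 * (state_of s).1 z + (- (m x)^-1) * (state_of s).1 x).
  by apply: linear_growthD; exact: linear_growthZ.
rewrite (real_dynkin LD t0 (edge_dynkin xz t0)) f2E !u_primitive //.
rewrite opprD addrACA; congr (_ + _).
rewrite -(RintegralB _ (integrable_avg (LN z) t0) (integrable_avg (LN x) t0)) //.
apply: eq_Rintegral => v; rewrite inE /= in_itv /= => /andP[v0 _].
rewrite avgD //; [|exact: linear_growthZ|exact: linear_growthZ].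
by rewrite !avgZ // mulNr.
Qed.

Let boundary_avg x t : x \in V1 -> avg (N x) t = 0.
Proof.
move=> xV1; rewrite (_ : N x = fun=> 0) ?mean_cst //; apply/funext => s.
by rewrite /N state_of_boundary // f1E psiV1 // !mulr0.
Qed.

Let lipschitz_node x : locally_lipschitz (avg (N x)).
Proof.
have [xV1|xV1] := boolP (x \in V1).
  move=> T T0; exists 0 => // s t _ _; by rewrite !boundary_avg // subrr normr0 mul0r.
apply: (primitive_lipschitz (g := avg (fun s => (m x)^-1 * \sum_(z <- nbrs x) k x z * E x z s))
  (c := psi x)).
- by move=> t t0; apply: integrable_avg => //; exact: linear_growthZ.
- by move=> t t0; exact: node_primitive.
- by move=> T T0; apply: avg_bounded => //; exact: linear_growthZ.
Qed.

Let lipschitz_u x : locally_lipschitz (u x).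
Proof.
apply: (primitive_lipschitz (g := avg (N x)) (c := phi x)).
- by move=> t t0; exact: integrable_avg.
- by move=> t t0; exact: u_primitive.
- by move=> T T0; exact: avg_bounded.
Qed.

Let avg_force x t : 0 <= t ->
  avg (fun s => (m x)^-1 * \sum_(z <- nbrs x) k x z * E x z s) t =
  (m x)^-1 * \sum_(z <- nbrs x) k x z * (u z t - u x t).
Proof.
move=> t0; rewrite avgZ //; congr (_ * _).
rewrite (mean_sum marked_clocks_IPS growth_rate_ge0 total_rate_state_of) //.
rewrite big_seq [RHS]big_seq; apply: eq_bigr => z; rewrite nbrsE => xz.
by rewrite avgZ ?edge_diff //; exact: linear_growth_edge.
Qed.

(** By [avg_force] this average is a finite linear combination of differences of [u], so its
    regularity comes from [lipschitz_u]; it is what makes the second derivative exist at every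
    time. *)
Let lipschitz_force x :
  locally_lipschitz (avg (fun s => (m x)^-1 * \sum_(z <- nbrs x) k x z * E x z s)).
Proof.
move=> T T0.
have uB z : locally_lipschitz (fun t => u z t - u x t) by exact: locally_lipschitzB.
have [L L0 hL] := locally_lipschitz_sum (nbrs x) (k x) uB T0.
exists ((m x)^-1 * L) => [|s t sT tT]; first by rewrite mulr_ge0 // invr_ge0 ltW.
have [s0 _] := andP sT; have [t0 _] := andP tT.
rewrite !avg_force // -mulrBr normrM gtr0_norm ?invr_gt0 // -mulrA.
by rewrite ler_wpM2l ?hL // invr_ge0 ltW.
Qed.

Lemma IPS_solves_wave :
  (forall x t, 0 <= t -> P.-integrable [set: Omega] (occ adj V1 f e xi x t)) /\
  exists u1 u2 : V -> R -> R,
    (forall x, deriv_nonneg (u x) (u1 x) /\ deriv_nonneg (u1 x) (u2 x)) /\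
    (forall x t, x \notin V1 -> 0 <= t ->
       m x * u2 x t = \sum_(y \in [set: V]) k x y * (u y t - u x t)) /\
    (forall x, u x 0 = phi x /\ u1 x 0 = psi x) /\
    (forall x t, x \in V1 -> 0 <= t -> u x t = phi x).
Proof.
split.
  move=> x t t0; have := integrable_occupation marked_clocks_IPS growth_rate_ge0
    total_rate_state_of (linear_growth_node x) t0.
  apply: eq_integrable => // w _; apply: eq_integral => v _.
  by rewrite state_of_history.
(* On [V1] node values are frozen at [m x * psi x = 0], so velocity and acceleration vanish there;
   elsewhere the acceleration is the averaged force divided by the mass. *)
exists (fun x => avg (N x)), (fun x t => if x \in V1 then 0 else
  avg (fun s => (m x)^-1 * \sum_(z <- nbrs x) k x z * E x z s) t).
split; [|split; [|split]].
- move=> x; split.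
    apply: (primitive_deriv (c := phi x)) => //.
    + by move=> t t0; exact: integrable_avg.
    + by move=> t t0; exact: u_primitive.
  have [xV1|xV1] := boolP (x \in V1).
    move=> t t0; rewrite (_ : (fun s => _) = fun=> 0); first exact: cvg_cst.
    by apply/funext => s; rewrite !boundary_avg // subrr mul0r.
  apply: (primitive_deriv (c := psi x)) => //.
  + by move=> t t0; apply: integrable_avg => //; exact: linear_growthZ.
  + by move=> t t0; exact: node_primitive.
- move=> x t xV1 t0; rewrite (negbTE xV1) avg_force // mulVKf ?gt_eqF //.
  rewrite (fsbig_seq _ _ (nbrs_uniq x)); apply: fsbig_widen => // y [_ /= /negP].
  by rewrite nbrsE => /kadj ->; rewrite mul0r.
- move=> x; split; first by rewrite u_primitive // set_itv1 Rintegral_set1 addr0.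
  have [xV1|xV1] := boolP (x \in V1); first by rewrite boundary_avg // psiV1.
  by rewrite node_primitive // set_itv1 Rintegral_set1 addr0.
- move=> x t xV1 t0; rewrite u_primitive //.
  have -> : \int[leb]_(v in `[0, t]) avg (N x) v = \int[leb]_(v in `[0, t]) 0.
    by apply: eq_Rintegral => v _; rewrite boundary_avg.
  by rewrite Rintegral_cst // mul0r addr0.
Qed.

End process.
End graph.

Unset Implicit Arguments. Set Strict Implicit.

Theorem theorem3p1 (R : realType) (V : countType)
  (adj : rel V) (k : V -> V -> R) (m : V -> R) (V1 : pred V)
  (d : measure_display) (Omega : measurableType d) (P : probability Omega R)
  (phi psi : V -> R)
  (e : nat -> Omega -> event V) (xi : nat -> Omega -> \bar R) :
  (forall x y, adj x y = adj y x) ->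
  (forall x, ~~ adj x x) ->
  (forall x y, k x y = k y x) ->
  (forall x y, 0 <= k x y) ->
  (forall x y, ~~ adj x y -> k x y = 0) ->
  (forall x, 0 < m x) ->
  (exists d0 : nat, forall x, exists s : seq V,
      (size s <= d0)%N /\ forall y, adj x y -> y \in s) ->
  (exists M : R, (forall x, (m x)^-1 <= M) /\
                 (forall x y, adj x y -> k x y <= M)) ->
  (forall x, x \in V1 -> psi x = 0) ->
  let f : state R V := (fun x => m x * psi x, fun x y => phi y - phi x) in
  inF0 adj f ->
  is_IPS P adj V1 m k f e xi ->
  let u := u_sol P adj V1 m phi f e xi in
  (forall x t, 0 <= t ->
     P.-integrable [set: Omega] (occ adj V1 f e xi x t)) /\
  exists u1 u2 : V -> R -> R,
    (forall x, deriv_nonneg (u x) (u1 x) /\ deriv_nonneg (u1 x) (u2 x)) /\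
    (forall x t, x \notin V1 -> 0 <= t ->
       m x * u2 x t = \sum_(y \in [set: V]) k x y * (u y t - u x t)) /\
    (forall x, u x 0 = phi x /\ u1 x 0 = psi x) /\
    (forall x t, x \in V1 -> 0 <= t -> u x t = phi x).
Proof.
move=> adjC adjxx kC k0 kadj m0 [d0 deg] [M [mM kM]] psiV1 f [_ [_ [fin1 fin2]]] ips u.
have [nb nbP] := choice deg.
(* The lists given by the degree bound may contain repetitions and nodes that are no neighbours;
   both are removed without increasing the length. *)
pose nbrs x := undup [seq y <- nb x | adj x y].
have [s1 s1E] := (finite_seqP _).1 fin1; have [s2 s2E] := (finite_seqP _).1 fin2.
(* The absolute value makes the constant nonnegative, so it also bounds [k x y = 0] for pairs that
   are not edges. *)
apply: (@IPS_solves_wave _ _ adj k m V1 nbrs d0 `|M|) => //.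
- move=> x y; rewrite mem_undup mem_filter; apply/andP/idP => [[]//|xy].
  by split => //; exact: (nbP x).2.
- by move=> x; exact: undup_uniq.
- move=> x; apply: leq_trans (nbP x).1; apply: leq_trans (size_undup _) _.
  by rewrite size_filter count_size.
- by move=> x; apply: le_trans (mM x) (ler_norm _).
- move=> x y; have [xy|xy] := boolP (adj x y); last by rewrite kadj.
  by apply: le_trans (kM _ _ xy) (ler_norm _).
- split; last by move=> x y; rewrite opprB.
  exists s1, s2; split => [x fx|x y xy fxy].
    by have : [set` s1] x by rewrite -s1E.
  by have : [set` s2] (x, y) by rewrite -s2E.
Qed.
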